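(* Let $C$ be an algebraically closed field of characteristic zero, let $R$ be a complete local noetherian $C$-algebra with maximal ideal $\mathfrak r$ and residue field $C$, and let $\tau\subset C$ be a subset such that the natural map $\tau\to C/\mathbb Z$ is bijective. Let $(\mathcal M,\nabla_{\mathcal M})\in\mathbf{MC}_{\log}(R[[x]]/R)$ be such that $\mathcal M$ is a free $R[[x]]$-module and let $(M,\nabla_M)=\gamma(\mathcal M,\nabla_{\mathcal M})$ be the associated regular-singular connection. Then there exists a pair $(W,B)$, with $W$ a free $R$-module of finite rank and $B:W\to W$ an $R$-linear endomorphism, such that $(M,\nabla_M)\simeq\gamma\,eul(W,B)$. In addition, the eigenvalues of the endomorphism of $W/\mathfrak rW$ defined by $B$ all belong to $\tau$. Otherwise said: consider a differential system $\vartheta\boldsymbol y=A\boldsymbol y$ defined by $A\in\mathrm M_r(R[[x]])$. There exists $P\in\mathrm{GL}_r(R((x)))$ such that, writing $\boldsymbol y=P\boldsymbol z$, we arrive at the system $\vartheta\boldsymbol z=B\boldsymbol z$ in which $B$ belongs to $\mathrm M_r(R)$ and its image in $\mathrm M_r(C)$ only has eigenvalues lying in $\tau$.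
   Context: $R((x))=R[[x]][x^{-1}]$ and $\vartheta(\sum a_nx^n)=\sum na_nx^n$. $\mathbf{MC}_{\log}(R[[x]]/R)$ (resp. $\mathbf{MC}(R((x))/R)$): pairs $(\mathcal M,\nabla)$ with $\mathcal M$ a finitely generated $R[[x]]$-module (resp. $R((x))$-module) and $\nabla$ an $R$-linear endomorphism with $\nabla(fm)=\vartheta(f)m+f\nabla(m)$; arrows are linear maps commuting with $\nabla$. $\gamma:\mathbf{MC}_{\log}(R[[x]]/R)\to\mathbf{MC}(R((x))/R)$ is the functor inverting $x$. For a finitely generated $R$-module $W$ and an $R$-linear $B:W\to W$, $eul(W,B)=(R[[x]]\otimes_RW,D_B)$ with $D_B(f\otimes w)=\vartheta(f)\otimes w+f\otimes Bw$. *)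

(* Defs.v *)
From HB Require Import structures.
From mathcomp Require Import all_boot all_algebra.
From mathcomp Require Import zify boolp classical_sets cardinality.

Set Implicit Arguments.
Unset Strict Implicit.
Unset Printing Implicit Defensive.

Import GRing.Theory.
Local Open Scope ring_scope.
Local Open Scope quotient_scope.

(* A record, and not a transparent alias of [nat -> R], so that the Cauchy
   product cannot be confused with the pointwise product of functions. *)
Record fps (R : Type) := Fps { fcoef : nat -> R }.

Lemma fpsP (R : Type) (f g : fps R) : (forall n, fcoef f n = fcoef g n) -> f = g.
Proof. by case: f g => [f] [g] /= /funext ->. Qed.

HB.instance Definition _ (R : Type) := gen_eqMixin (fps R).
HB.instance Definition _ (R : Type) := gen_choiceMixin (fps R).

Section FpsRing.
Variable R : comNzRingType.
Implicit Types f g h : fps R.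

Definition fps_zero : fps R := Fps (fun=> 0).
Definition fps_opp f : fps R := Fps (fun n => - fcoef f n).
Definition fps_add f g : fps R := Fps (fun n => fcoef f n + fcoef g n).
Definition fps_one : fps R := Fps (fun n => (n == 0%N)%:R).
Definition fps_mul f g : fps R :=
  Fps (fun n => \sum_(i < n.+1) fcoef f i * fcoef g (n - i)%N).
Definition fps_scale (a : R) f : fps R := Fps (fun n => a * fcoef f n).

Fact fps_addA : associative fps_add.
Proof. by move=> f g h; apply: fpsP => n /=; rewrite addrA. Qed.
Fact fps_addC : commutative fps_add.
Proof. by move=> f g; apply: fpsP => n /=; rewrite addrC. Qed.
Fact fps_add0 : left_id fps_zero fps_add.
Proof. by move=> f; apply: fpsP => n /=; rewrite add0r. Qed.
Fact fps_addN : left_inverse fps_zero fps_opp fps_add.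
Proof. by move=> f; apply: fpsP => n /=; rewrite addNr. Qed.

HB.instance Definition _ :=
  GRing.isZmodule.Build (fps R) fps_addA fps_addC fps_add0 fps_addN.

Let trunc n f : {poly R} := \poly_(i < n.+1) fcoef f i.

Let trunc_mul n f g k : (k <= n)%N ->
  (trunc n f * trunc n g)`_k = fcoef (fps_mul f g) k.
Proof.
move=> kn; rewrite coefM /=; apply: eq_bigr => i _; rewrite !coef_poly.
have ik : (i <= k)%N by rewrite -ltnS.
by rewrite !ltnS (leq_trans ik kn) (leq_trans (leq_subr _ _) kn).
Qed.

Let trunc_coef n f k : (k <= n)%N -> (trunc n f)`_k = fcoef f k.
Proof. by move=> kn; rewrite coef_poly ltnS kn. Qed.

Fact fps_mulC : commutative fps_mul.
Proof.
by move=> f g; apply: fpsP => n; rewrite -!(@trunc_mul n) // mulrC.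
Qed.

Fact fps_mulA : associative fps_mul.
Proof.
move=> f g h; apply: fpsP => n /=.
transitivity ((trunc n f * (trunc n g * trunc n h))`_n).
  rewrite coefM; apply: eq_bigr => i _.
  have i_n : (i <= n)%N by rewrite -ltnS.
  by rewrite trunc_coef // trunc_mul // leq_subr.
rewrite mulrA coefM; apply: eq_bigr => i _.
have i_n : (i <= n)%N by rewrite -ltnS.
by rewrite trunc_mul // trunc_coef // leq_subr.
Qed.

Fact fps_mul1 : left_id fps_one fps_mul.
Proof.
move=> f; apply: fpsP => n /=; rewrite big_ord_recl /= mul1r subn0.
by rewrite big1 ?addr0 // => i _; rewrite mul0r.
Qed.

Fact fps_mulD : left_distributive fps_mul fps_add.
Proof.
move=> f g h; apply: fpsP => n /=; rewrite -big_split /=.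
by apply: eq_bigr => i _; rewrite mulrDl.
Qed.

Fact fps_1neq0 : fps_one != 0.
Proof. by apply/eqP => /(congr1 (fun f : fps R => fcoef f 0))/eqP; rewrite /= oner_eq0. Qed.

HB.instance Definition _ := GRing.Zmodule_isComNzRing.Build (fps R)
  fps_mulA fps_mulC fps_mul1 fps_mulD fps_1neq0.

Fact fps_scaleA a b f : fps_scale a (fps_scale b f) = fps_scale (a * b) f.
Proof. by apply: fpsP => n /=; rewrite mulrA. Qed.
Fact fps_scale1 : left_id 1 fps_scale.
Proof. by move=> f; apply: fpsP => n /=; rewrite mul1r. Qed.
Fact fps_scaleDr : right_distributive fps_scale +%R.
Proof. by move=> a f g; apply: fpsP => n /=; rewrite mulrDr. Qed.
Fact fps_scaleDl f : {morph fps_scale^~ f : a b / a + b}.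
Proof. by move=> a b; apply: fpsP => n /=; rewrite mulrDl. Qed.

HB.instance Definition _ := GRing.Zmodule_isLmodule.Build R (fps R)
  fps_scaleA fps_scale1 fps_scaleDr fps_scaleDl.

Fact fps_scaleAl (a : R) f g : a *: (f * g) = (a *: f) * g.
Proof.
apply: fpsP => n /=; rewrite big_distrr /=.
by apply: eq_bigr => i _; rewrite mulrA.
Qed.

HB.instance Definition _ := GRing.Lmodule_isLalgebra.Build R (fps R) fps_scaleAl.
HB.instance Definition _ := GRing.Lalgebra_isComAlgebra.Build R (fps R).

Definition fpsX : fps R := Fps (fun n => (n == 1%N)%:R).

Definition fps_theta f : fps R := Fps (fun n => fcoef f n *+ n).

Lemma fcoefD f g n : fcoef (f + g) n = fcoef f n + fcoef g n.
Proof. by []. Qed.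

Lemma fcoefZ a f n : fcoef (a *: f) n = a * fcoef f n.
Proof. by []. Qed.

Lemma fcoefXM f n : fcoef (fpsX * f) n = if n is m.+1 then fcoef f m else 0.
Proof.
case: n => [|n] /=; first by rewrite big_ord1 mul0r.
rewrite !big_ord_recl /= mul0r add0r mul1r subn1 /=.
by rewrite big1 ?addr0 // => i _; rewrite mul0r.
Qed.

Lemma fcoefXnM k f n :
  fcoef (fpsX ^+ k * f) n = if (n < k)%N then 0 else fcoef f (n - k).
Proof.
elim: k n => [|k IH] n; first by rewrite expr0 mul1r subn0.
by rewrite exprS -mulrA fcoefXM; case: n => [|n] //; rewrite IH.
Qed.

Lemma fpsXn_inj k : injective (fun f => fpsX ^+ k * f).
Proof.
move=> f g /(congr1 (@fcoef R)) E; apply: fpsP => n.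
by move/(congr1 (@^~ (n + k)%N)): E; rewrite !fcoefXnM ltnNge leq_addl /= addnK.
Qed.

Lemma fps_thetaD f g : fps_theta (f + g) = fps_theta f + fps_theta g.
Proof. by apply: fpsP => n /=; rewrite mulrnDl. Qed.

Lemma fps_thetaZ a f : fps_theta (a *: f) = a *: fps_theta f.
Proof. by apply: fpsP => n /=; rewrite mulrnAr. Qed.

Lemma fps_thetaM f g : fps_theta (f * g) = fps_theta f * g + f * fps_theta g.
Proof.
apply: fpsP => n /=; rewrite -big_split -sumrMnl /=; apply: eq_bigr => i _.
by rewrite mulrnAl mulrnAr -mulrnDr subnKC // -ltnS.
Qed.

Lemma fps_thetaX : fps_theta fpsX = fpsX.
Proof. by apply: fpsP => -[|[|n]] /=; rewrite ?mul0rn. Qed.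

Lemma fps_thetaXn k : fps_theta (fpsX ^+ k) = fpsX ^+ k *+ k.
Proof.
elim: k => [|k IH]; last first.
  by rewrite exprS fps_thetaM fps_thetaX IH mulrnAr -mulrS.
by rewrite expr0 mulr0n; apply: fpsP => -[|n] /=; rewrite ?mul0rn.
Qed.

End FpsRing.

Arguments fpsX {R}.

Section Modules.
Variables (A : comNzRingType) (V : lmodType A).

Definition fin_gen : Prop :=
  exists (n : nat) (e : 'I_n -> V),
    forall v, exists c : 'I_n -> A, v = \sum_i c i *: e i.

Definition is_basis (S : set V) : Prop :=
  (forall v, exists (s : seq V) (c : V -> A),
     [/\ uniq s, (forall e, e \in s -> S e) & v = \sum_(e <- s) c e *: e])
  /\ (forall (s : seq V) (c : V -> A),
     uniq s -> (forall e, e \in s -> S e) ->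
     \sum_(e <- s) c e *: e = 0 -> forall e, e \in s -> c e = 0).

Definition is_free : Prop := exists S : set V, is_basis S.

Definition is_free_finite_rank : Prop :=
  exists2 S : set V, finite_set S & is_basis S.

End Modules.

Section Localization.
Variables (R : comNzRingType) (M : lmodType (fps R)).
Implicit Types (m n p : M) (i j k : nat).

Definition loc_rel : rel (M * nat) := fun u v =>
  `[< exists k, fpsX ^+ (k + v.2) *: u.1 = fpsX ^+ (k + u.2) *: v.1 >].

Fact loc_rel_equiv : equiv_class_of loc_rel.
Proof.
split=> [u|u v|v u w]; first by apply/asboolP; exists 0%N.
  by apply/asboolP/asboolP => -[k E]; exists k.
move=> /asboolP[k E] /asboolP[l F]; apply/asboolP; exists (k + l + v.2)%N.
have := congr1 ( *:%R (fpsX ^+ (l + w.2))) E.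
have := congr1 ( *:%R (fpsX ^+ (k + u.2))) F.
rewrite !scalerA -!exprD => F' E'.
have -> : (k + l + v.2 + w.2 = l + w.2 + (k + v.2))%N by lia.
have -> : (k + l + v.2 + u.2 = k + u.2 + (l + v.2))%N by lia.
by rewrite E' -F' (addnC (l + w.2)%N).
Qed.

Canonical loc_equivRel := EquivRelPack loc_rel_equiv.

(* M[x^-1], built from fractions; the pair (m, i) stands for x^-i m. *)
Definition locmod := {eq_quot loc_equivRel}.

HB.instance Definition _ := Choice.on locmod.
HB.instance Definition _ := EqQuotient.on locmod.

Definition mkloc m i : locmod := \pi_locmod (m, i).

Lemma mklocP m i n j :
  mkloc m i = mkloc n j <->
  exists k, fpsX ^+ (k + j) *: m = fpsX ^+ (k + i) *: n.
Proof. by rewrite /mkloc; split=> [/eqmodP/asboolP|H]; last exact/eqmodP/asboolP. Qed.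

Lemma mkloc_eq m i n j :
  fpsX ^+ j *: m = fpsX ^+ i *: n -> mkloc m i = mkloc n j.
Proof. by move=> E; apply/mklocP; exists 0%N. Qed.

Lemma locmod_ind (P : locmod -> Prop) :
  (forall m i, P (mkloc m i)) -> forall u, P u.
Proof. by move=> H u; rewrite -[u]reprK; case: (repr u) => m i; exact: H. Qed.

Definition loc_zero : locmod := mkloc 0 0.
Definition loc_opp (u : locmod) : locmod := mkloc (- (repr u).1) (repr u).2.
Definition loc_add (u v : locmod) : locmod :=
  mkloc (fpsX ^+ (repr v).2 *: (repr u).1 + fpsX ^+ (repr u).2 *: (repr v).1)
        ((repr u).2 + (repr v).2).

Let repr_mkloc m i : exists k,
  fpsX ^+ (k + i) *: (repr (mkloc m i)).1 = fpsX ^+ (k + (repr (mkloc m i)).2) *: m.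
Proof. by apply/mklocP; rewrite /mkloc -surjective_pairing reprK. Qed.

Let Xcong a m b n c a' b' : fpsX ^+ a *: m = fpsX ^+ b *: n ->
  a' = (c + a)%N -> b' = (c + b)%N -> fpsX ^+ a' *: m = fpsX ^+ b' *: n.
Proof. by move=> E -> ->; rewrite !exprD -!scalerA E. Qed.

Lemma loc_oppE m i : loc_opp (mkloc m i) = mkloc (- m) i.
Proof.
rewrite /loc_opp; have [k E] := repr_mkloc m i.
by apply/mklocP; exists k; rewrite !scalerN E.
Qed.

Lemma loc_addE m i n j :
  loc_add (mkloc m i) (mkloc n j) =
  mkloc (fpsX ^+ j *: m + fpsX ^+ i *: n) (i + j).
Proof.
rewrite /loc_add; have [k E] := repr_mkloc m i; have [l F] := repr_mkloc n j.
case: (repr (mkloc m i)) (repr (mkloc n j)) E F => [m' i'] [n' j'] /= E F.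
apply/mklocP; exists (k + l)%N; rewrite !scalerDr !scalerA -!exprD; congr (_ + _).
  by apply: (Xcong (c := l + j + j') E); lia.
by apply: (Xcong (c := k + i + i') F); lia.
Qed.

Fact loc_addA : associative loc_add.
Proof.
elim/locmod_ind=> m i; elim/locmod_ind=> n j; elim/locmod_ind=> p k.
rewrite !loc_addE; apply: mkloc_eq.
rewrite !scalerDr !scalerA -!exprD addrA; congr (_ + _ + _).
all: by congr (_ ^+ _ *: _); lia.
Qed.

Fact loc_addC : commutative loc_add.
Proof.
elim/locmod_ind=> m i; elim/locmod_ind=> n j.
by rewrite !loc_addE addrC addnC.
Qed.

Fact loc_add0 : left_id loc_zero loc_add.
Proof.
by elim/locmod_ind=> m i; rewrite loc_addE scaler0 add0r expr0 scale1r.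
Qed.

Fact loc_addN : left_inverse loc_zero loc_opp loc_add.
Proof.
elim/locmod_ind=> m i; rewrite loc_oppE loc_addE scalerN addNr.
by apply: mkloc_eq; rewrite !scaler0.
Qed.

HB.instance Definition _ :=
  GRing.isZmodule.Build locmod loc_addA loc_addC loc_add0 loc_addN.

Lemma mklocD m i n j :
  mkloc m i + mkloc n j = mkloc (fpsX ^+ j *: m + fpsX ^+ i *: n) (i + j).
Proof. exact: loc_addE. Qed.

Lemma mklocN m i : - mkloc m i = mkloc (- m) i.
Proof. exact: loc_oppE. Qed.

(* The extension of a map satisfying the Leibniz rule for x d/dx:
   D (x^-i m) = x^-i (D m - i m). *)
Definition loc_map (D : M -> M) (u : locmod) : locmod :=
  mkloc (D (repr u).1 - (repr u).1 *+ (repr u).2) (repr u).2.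

Lemma loc_mapE (D : M -> M) m i :
  (forall f n, D (f *: n) = fps_theta f *: n + f *: D n) ->
  loc_map D (mkloc m i) = mkloc (D m - m *+ i) i.
Proof.
move=> DZ; rewrite /loc_map; have [k E] := repr_mkloc m i.
move: (repr _) E => [m' i'] /= E.
apply/mklocP; exists k.
have := congr1 D E; rewrite !DZ !fps_thetaXn => F.
rewrite !scalerBr -!scalerMnr.
have G a b n : (fpsX ^+ a *+ b) *: n = (fpsX ^+ a *: n) *+ b :> M.
  by rewrite scalerMnl.
move: F; rewrite !G !E => F.
apply/eqP; rewrite subr_eq addrAC eq_sym subr_eq eq_sym; apply/eqP.
apply: (addrI ((fpsX ^+ (k + i') *: m) *+ k)).
rewrite [in RHS]addrCA [RHS]addrC addrA -mulrnDr -F.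
by rewrite addrAC -mulrnDr.
Qed.

End Localization.

(* R((x)) = R[[x]][x^-1]; [mklau f i] is x^-i f. *)
Definition laurent (R : comNzRingType) := locmod (fps R)^o.

HB.instance Definition _ (R : comNzRingType) := GRing.Zmodule.on (laurent R).

Definition mklau (R : comNzRingType) (f : fps R) (i : nat) : laurent R :=
  @mkloc R (fps R)^o f i.

Section Scale.
Variables (R : comNzRingType) (M : lmodType (fps R)).
Implicit Types (a b : laurent R) (u v : locmod M).

Definition loc_scale a u : locmod M :=
  mkloc (((repr a).1 : fps R) *: (repr u).1) ((repr a).2 + (repr u).2).

Lemma loc_scaleE (f : fps R) i (m : M) j :
  loc_scale (mklau f i) (mkloc m j) = mkloc (f *: m) (i + j).
Proof.
have: mkloc (repr (mkloc m j)).1 (repr (mkloc m j)).2 = mkloc m j.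
  by rewrite /mkloc -surjective_pairing reprK.
have: mklau (repr (mklau f i)).1 (repr (mklau f i)).2 = mklau f i.
  by rewrite /mklau /mkloc -surjective_pairing reprK.
rewrite /loc_scale; case: (repr (mklau f i)) (repr (mkloc m j)) => [f' i'] [m' j'] /=.
move=> /mklocP[k E] /mklocP[l F]; apply/mklocP; exists (k + l)%N.
have {}E : fpsX ^+ (k + i) * f' = fpsX ^+ (k + i') * f by [].
have -> : (k + l + (i + j) = (k + i) + (l + j))%N by lia.
have -> : (k + l + (i' + j') = (k + i') + (l + j'))%N by lia.
have swap p q g (n : M) : fpsX ^+ (p + q) *: (g *: n) = (fpsX ^+ p * g) *: (fpsX ^+ q *: n).
  by rewrite !scalerA exprD mulrAC.
by rewrite !swap E F.
Qed.

End Scale.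

Section LaurentRing.
Variable R : comNzRingType.
Implicit Types a b c : laurent R.

Definition lau_one : laurent R := mklau 1 0.
Definition lau_mul a b : laurent R := loc_scale a b.

Lemma lau_ind (P : laurent R -> Prop) :
  (forall f i, P (mklau f i)) -> forall a, P a.
Proof. exact: (@locmod_ind R (fps R)^o P). Qed.

Lemma mklauP (f g : fps R) i j :
  mklau f i = mklau g j <->
  exists k, fpsX ^+ (k + j) * f = fpsX ^+ (k + i) * g.
Proof. exact: (@mklocP R (fps R)^o). Qed.

Lemma mklau_eq (f g : fps R) i j :
  fpsX ^+ j * f = fpsX ^+ i * g -> mklau f i = mklau g j.
Proof. exact: (@mkloc_eq R (fps R)^o). Qed.

Lemma mklauD (f g : fps R) i j :
  mklau f i + mklau g j = mklau (fpsX ^+ j * f + fpsX ^+ i * g) (i + j).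
Proof. exact: (@mklocD R (fps R)^o). Qed.

Lemma lau_mulE (f g : fps R) i j :
  lau_mul (mklau f i) (mklau g j) = mklau (f * g) (i + j).
Proof. exact: loc_scaleE. Qed.

Fact lau_mulA : associative lau_mul.
Proof.
elim/lau_ind=> f i; elim/lau_ind=> g j; elim/lau_ind=> h k.
by rewrite !lau_mulE mulrA addnA.
Qed.

Fact lau_mulC : commutative lau_mul.
Proof.
by elim/lau_ind=> f i; elim/lau_ind=> g j; rewrite !lau_mulE mulrC addnC.
Qed.

Fact lau_mul1 : left_id lau_one lau_mul.
Proof. by elim/lau_ind=> f i; rewrite lau_mulE mul1r add0n. Qed.

Fact lau_mulD : left_distributive lau_mul +%R.
Proof.
elim/lau_ind=> f i; elim/lau_ind=> g j; elim/lau_ind=> h k.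
rewrite !(mklauD, lau_mulE); apply: mklau_eq.
rewrite !(mulrDl, mulrDr) !mulrA -!exprD.
by congr (_ ^+ _ * _ * _ + _ ^+ _ * _ * _); lia.
Qed.

Fact lau_1neq0 : lau_one != 0.
Proof.
apply/eqP => /mklauP[k]; rewrite mulr1 mulr0 => /(congr1 (fun f : fps R => fcoef f k)).
move: (fcoefXnM k (1 : fps R) k); rewrite mulr1 addn0 ltnn subnn /= => ->.
by apply/eqP; rewrite oner_eq0.
Qed.

HB.instance Definition _ := GRing.Zmodule_isComNzRing.Build (laurent R)
  lau_mulA lau_mulC lau_mul1 lau_mulD lau_1neq0.

Definition lau_unit : {pred laurent R} := fun a => `[< exists b, b * a = 1 >].
Definition lau_inv a : laurent R := xget a [set b | b * a = 1]%classic.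

Fact lau_mulV : {in lau_unit, left_inverse 1 lau_inv *%R}.
Proof.
by move=> a /asboolP[b ba]; rewrite /lau_inv; case: xgetP => [c _ //|/(_ b)/(_ ba)].
Qed.

Fact lau_unitP a b : b * a = 1 -> a \in lau_unit.
Proof. by move=> ba; apply/asboolP; exists b. Qed.

Fact lau_invN : {in [predC lau_unit], lau_inv =1 id}.
Proof.
move=> a /negP ua; rewrite /lau_inv; case: xgetP => [c _ ca|//].
by case: ua; apply: lau_unitP ca.
Qed.

HB.instance Definition _ := GRing.ComNzRing_hasMulInverse.Build (laurent R)
  lau_mulV lau_unitP lau_invN.

Lemma mklauM (f g : fps R) i j : mklau f i * mklau g j = mklau (f * g) (i + j).
Proof. exact: lau_mulE. Qed.

Definition lau_of_fps (f : fps R) : laurent R := mklau f 0.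
Definition lau_const (a : R) : laurent R := lau_of_fps a%:A.

Fact lau_of_fps_is_zmod_morphism : zmod_morphism lau_of_fps.
Proof.
move=> f g; rewrite /lau_of_fps.
by rewrite (_ : - mklau g 0 = mklau (- g) 0) ?mklauD ?expr0 ?mul1r //; apply: mklocN.
Qed.

Fact lau_of_fps_is_monoid_morphism : monoid_morphism lau_of_fps.
Proof. by split=> // f g; rewrite mklauM. Qed.

HB.instance Definition _ :=
  GRing.isZmodMorphism.Build (fps R) (laurent R) lau_of_fps lau_of_fps_is_zmod_morphism.
HB.instance Definition _ :=
  GRing.isMonoidMorphism.Build (fps R) (laurent R) lau_of_fps lau_of_fps_is_monoid_morphism.

HB.instance Definition _ := GRing.RMorphism.copy lau_const
  (lau_of_fps \o GRing.in_alg (fps R)).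

Definition lau_theta : laurent R -> laurent R :=
  @loc_map R (fps R)^o (@fps_theta R).

Lemma lau_thetaE (f : fps R) i :
  lau_theta (mklau f i) = mklau (fps_theta f - f *+ i) i.
Proof. by apply: loc_mapE => g h; apply: fps_thetaM. Qed.

Definition lau_coef (a : laurent R) (n : int) : R :=
  if (n + (repr a).2%:Z)%R is Posz m then fcoef (repr a).1 m else 0.

Lemma lau_coefE (f : fps R) i (n : int) :
  lau_coef (mklau f i) n = if (n + i%:Z)%R is Posz m then fcoef f m else 0.
Proof.
rewrite /lau_coef; have: mklau (repr (mklau f i)).1 (repr (mklau f i)).2 = mklau f i.
  by rewrite /mklau /mkloc -surjective_pairing reprK.
case: (repr (mklau f i)) => [g j] /= /mklauP[k E].
have F p := congr1 (fun h : fps R => fcoef h p) E.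
case D0: (n + (k + i + j)%N%:Z)%R => [m|m].
  have := F m; rewrite !fcoefXnM.
  case D: (n + j%:Z)%R => [p|p]; case D': (n + i%:Z)%R => [p'|p'].
  - rewrite !ifF; [|lia|lia].
    by have -> : (m - (k + i) = p)%N by [lia]; have -> : (m - (k + j) = p')%N by [lia].
  - rewrite ifF ?ifT; [|lia|lia].
    by have -> : (m - (k + i) = p)%N by [lia].
  - rewrite ifT ?ifF; [|lia|lia].
    by have -> : (m - (k + j) = p')%N by [lia].
  - by [].
by case D: (n + j%:Z)%R => [p|p]; case D': (n + i%:Z)%R => [p'|p'] //; lia.
Qed.

Lemma lau_coef_theta (a : laurent R) n :
  lau_coef (lau_theta a) n = lau_coef a n *~ n.
Proof.
elim/lau_ind: a => f i; rewrite lau_thetaE !lau_coefE.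
case D: (n + i%:Z)%R => [p|p]; last by rewrite mul0rz.
have -> : n = p%:Z - i%:Z by lia.
by rewrite mulrzBr fcoefD /= -!pmulrn; congr (_ - _); elim: i {D} => [|i IH];
  rewrite ?mulrS ?fcoefD ?IH.
Qed.

End LaurentRing.

Section LocalizedModule.
Variables (R : comNzRingType) (M : lmodType (fps R)).
Implicit Types (a b : laurent R) (u v : locmod M).

Fact loc_scaleA a b u : loc_scale a (loc_scale b u) = loc_scale (a * b) u.
Proof.
elim/lau_ind: a => f i; elim/lau_ind: b => g j; elim/locmod_ind: u => m k.
by rewrite mklauM !loc_scaleE scalerA addnA.
Qed.

Fact loc_scale1 : left_id 1 (@loc_scale R M).
Proof. by elim/locmod_ind=> m k; rewrite loc_scaleE scale1r. Qed.

Fact loc_scaleDr : right_distributive (@loc_scale R M) +%R.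
Proof.
elim/lau_ind=> f i; elim/locmod_ind=> m j; elim/locmod_ind=> n k.
rewrite mklocD !loc_scaleE mklocD; apply: mkloc_eq.
rewrite !scalerDr !scalerA -!mulrA ![f * _]mulrC !mulrA -!exprD.
by congr ((_ ^+ _ * _) *: _ + (_ ^+ _ * _) *: _); lia.
Qed.

Fact loc_scaleDl u : {morph (@loc_scale R M)^~ u : a b / a + b}.
Proof.
elim/lau_ind=> f i; elim/lau_ind=> g j; elim/locmod_ind: u => m k.
rewrite mklauD !loc_scaleE mklocD; apply: mkloc_eq.
rewrite !(scalerDr, scalerDl) !scalerA !mulrA -!exprD.
by congr ((_ ^+ _ * _) *: _ + (_ ^+ _ * _) *: _); lia.
Qed.

HB.instance Definition _ := GRing.Zmodule_isLmodule.Build (laurent R) (locmod M)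
  loc_scaleA loc_scale1 loc_scaleDr loc_scaleDl.

Lemma mklau_scale (f : fps R) i (m : M) j :
  mklau f i *: mkloc m j = mkloc (f *: m) (i + j).
Proof. exact: loc_scaleE. Qed.

End LocalizedModule.

Record connection (R A : comNzRingType) (iota : R -> A) (theta : A -> A) :=
  Connection {
    carrier :> lmodType A;
    nabla : carrier -> carrier;
    carrier_fg : fin_gen carrier;
    nabla_linear : forall a m n,
      nabla (iota a *: m + n) = iota a *: nabla m + nabla n;
    nabla_leibniz : forall f m,
      nabla (f *: m) = theta f *: m + f *: nabla m }.

Definition MC_log (R : comNzRingType) :=
  connection (GRing.in_alg (fps R)) (@fps_theta R).

Definition MC (R : comNzRingType) :=
  connection (@lau_const R) (@lau_theta R).

Section Morphisms.
Variables (R A : comNzRingType) (iota : R -> A) (theta : A -> A).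
Implicit Types M N : connection iota theta.

Definition conn_hom M N (phi : {linear M -> N}) : Prop :=
  forall m, phi (nabla m) = nabla (phi m).

Definition conn_iso M N : Prop :=
  exists (phi : {linear M -> N}) (psi : {linear N -> M}),
    [/\ conn_hom phi, conn_hom psi, cancel phi psi & cancel psi phi].

End Morphisms.

Section Gamma.
Variables (R : comNzRingType) (M : MC_log R).

Definition gamma_nabla : locmod M -> locmod M := loc_map (@nabla _ _ _ _ M).

Lemma gamma_nablaE (m : M) i :
  gamma_nabla (mkloc m i) = mkloc (nabla m - m *+ i) i.
Proof. exact/loc_mapE/nabla_leibniz. Qed.

Fact gamma_fg : @fin_gen (laurent R) (locmod M).
Proof.
have [n [e eP]] := carrier_fg M; exists n, (fun i => mkloc (e i) 0).
elim/locmod_ind=> m k; have [c ->] := eP m; exists (fun i => mklau (c i) k).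
have sumE (u : 'I_n -> M) : mkloc (\sum_i u i) k = \sum_i mkloc (u i) k.
  elim/big_ind2: _ => [|x x' y y' <- <-|//]; last first.
    rewrite mklocD -scalerDr; apply/esym/mkloc_eq.
    by rewrite scalerA -exprD.
  by apply: mkloc_eq; rewrite !scaler0.
by rewrite sumE; apply: eq_bigr => i _; rewrite mklau_scale addn0.
Qed.

Fact gamma_leibniz (f : laurent R) (u : locmod M) :
  gamma_nabla (f *: u) = lau_theta f *: u + f *: gamma_nabla u.
Proof.
elim/lau_ind: f => f i; elim/locmod_ind: u => m j.
rewrite mklau_scale !gamma_nablaE lau_thetaE !mklau_scale mklocD -scalerDr.
apply/esym/mkloc_eq; rewrite scalerA -exprD; congr (_ *: _).
rewrite nabla_leibniz scalerBl scalerBr addrACA; congr (_ + _).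
by rewrite -scalerMnl -scalerMnr mulrnDr opprD.
Qed.

Fact gamma_nablaD : {morph gamma_nabla : u v / u + v}.
Proof.
elim/locmod_ind=> m i; elim/locmod_ind=> n j.
have nD : {morph @nabla _ _ _ _ M : x y / x + y}.
  by move=> x y; have := nabla_linear 1 x y; rewrite rmorph1 !scale1r.
rewrite mklocD !gamma_nablaE mklocD nD !nabla_leibniz !fps_thetaXn.
congr mkloc; rewrite -!scalerMnl !scalerBr -!scalerMnr mulrnDl !mulrnDr.
rewrite !opprD addrACA [RHS]addrACA [in RHS]addrACA.
congr (_ + _); last by rewrite addrACA subrr add0r.
by rewrite [X in X + _]addrC -addrA [X in _ + X]addrC subrK.
Qed.

Fact gamma_linear a (u v : locmod M) :
  gamma_nabla (lau_const a *: u + v) = lau_const a *: gamma_nabla u + gamma_nabla v.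
Proof.
rewrite gamma_nablaD gamma_leibniz lau_thetaE mulr0n subr0.
rewrite fps_thetaZ -[1 : fps R](expr0 fpsX) fps_thetaXn mulr0n scaler0.
by rewrite (_ : mklau 0 0 = 0) ?scale0r ?add0r.
Qed.

Definition gamma : MC R := Connection gamma_fg gamma_linear gamma_leibniz.

End Gamma.

Section Tensor.
Variables (R : comNzRingType) (A : comAlgType R) (W : lmodType R).

(* A formal sum of pairs stands for the sum of the pure tensors a_i (x) w_i;
   [tens_rel] is the congruence generated by the relations of A (x)_R W. *)
Inductive tens_rel : seq (A * W) -> seq (A * W) -> Prop :=
| tens_refl s : tens_rel s s
| tens_sym s t : tens_rel s t -> tens_rel t s
| tens_trans s t u : tens_rel s t -> tens_rel t u -> tens_rel s u
| tens_cat s s' t t' : tens_rel s s' -> tens_rel t t' -> tens_rel (s ++ t) (s' ++ t')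
| tens_catC s t : tens_rel (s ++ t) (t ++ s)
| tens_zero w : tens_rel [:: (0, w)] [::]
| tens_addl a b w : tens_rel [:: (a + b, w)] [:: (a, w); (b, w)]
| tens_addr a v w : tens_rel [:: (a, v + w)] [:: (a, v); (a, w)]
| tens_bal c a w : tens_rel [:: (c *: a, w)] [:: (a, c *: w)].

Definition tens_relb : rel (seq (A * W)) := fun s t => `[< tens_rel s t >].

Fact tens_relb_equiv : equiv_class_of tens_relb.
Proof.
split=> [s|s t|t s u]; first exact/asboolP/tens_refl.
  by apply/asboolP/asboolP; apply: tens_sym.
by move=> /asboolP st /asboolP tu; apply/asboolP/(tens_trans st tu).
Qed.

Canonical tens_equivRel := EquivRelPack tens_relb_equiv.

Definition tens := {eq_quot tens_equivRel}.

HB.instance Definition _ := Choice.on tens.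
HB.instance Definition _ := EqQuotient.on tens.

Definition mktens (s : seq (A * W)) : tens := \pi_tens s.

Lemma mktensP s t : mktens s = mktens t <-> tens_rel s t.
Proof. by split=> [/eqmodP/asboolP|H]; last exact/eqmodP/asboolP. Qed.

Lemma repr_mktens s : tens_rel (repr (mktens s)) s.
Proof. by apply/mktensP; rewrite /mktens reprK. Qed.

Lemma tens_ind (P : tens -> Prop) : (forall s, P (mktens s)) -> forall u, P u.
Proof. by move=> H u; rewrite -[u]reprK; apply: H. Qed.

Definition tens_add (u v : tens) : tens := mktens (repr u ++ repr v).
Definition tens_mapl (h : A -> A) (u : tens) : tens :=
  mktens [seq (h p.1, p.2) | p <- repr u].

Lemma tens_addE s t : tens_add (mktens s) (mktens t) = mktens (s ++ t).
Proof. by apply/mktensP/tens_cat; apply: repr_mktens. Qed.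

Lemma tens_maplE (h : A -> A) s :
    {morph h : a b / a + b} -> (forall c a, h (c *: a) = c *: h a) ->
  tens_mapl h (mktens s) = mktens [seq (h p.1, p.2) | p <- s].
Proof.
move=> hD hZ; apply/mktensP; move: (repr_mktens s); move: (repr _) => t.
have h0 : h 0 = 0 by rewrite -(scale0r 0) hZ !scale0r.
elim=> {s t} [s|s t _|s t u _ IH1 _|s s' t t' _ IH1 _ IH2|s t|w|a b w|a v w|c a w] /=.
- exact: tens_refl.
- exact: tens_sym.
- exact: tens_trans.
- by rewrite !map_cat; apply: tens_cat.
- by rewrite !map_cat; apply: tens_catC.
- by rewrite h0; apply: tens_zero.
- by rewrite hD; apply: tens_addl.
- exact: tens_addr.
- by rewrite hZ; apply: tens_bal.
Qed.

Definition tens0 : tens := mktens [::].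
Definition tens_opp : tens -> tens := tens_mapl -%R.

Lemma tens_oppE s : tens_opp (mktens s) = mktens [seq (- p.1, p.2) | p <- s].
Proof. by apply: tens_maplE => [a b|c a]; rewrite ?opprD ?scalerN. Qed.

Fact tens_addA : associative tens_add.
Proof.
by elim/tens_ind=> s; elim/tens_ind=> t; elim/tens_ind=> u; rewrite !tens_addE catA.
Qed.

Fact tens_addC : commutative tens_add.
Proof.
elim/tens_ind=> s; elim/tens_ind=> t; rewrite !tens_addE.
exact/mktensP/tens_catC.
Qed.

Fact tens_add0 : left_id tens0 tens_add.
Proof. by elim/tens_ind=> s; rewrite tens_addE. Qed.

Fact tens_addN : left_inverse tens0 tens_opp tens_add.
Proof.
elim/tens_ind=> s; rewrite tens_oppE tens_addE; apply/mktensP.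
elim: s => [|[a w] s IH] /=; first exact: tens_refl.
apply: (tens_trans (t := [:: (- a, w); (a, w)] ++ (map (fun p => (- p.1, p.2)) s ++ s))).
  rewrite -[_ :: _]/([:: (- a, w)] ++ (map _ s ++ [:: (a, w)] ++ s)).
  rewrite -[[:: _; _] ++ _]/([:: (- a, w)] ++ ([:: (a, w)] ++ (map _ s ++ s))).
  apply: tens_cat; first exact: tens_refl.
  by rewrite !catA; apply: tens_cat; [apply: tens_catC | apply: tens_refl].
rewrite -[[::]]/([::] ++ [::]); apply: tens_cat => //.
apply: tens_trans (tens_zero w); rewrite -(addNr a).
exact/tens_sym/tens_addl.
Qed.

HB.instance Definition _ :=
  GRing.isZmodule.Build tens tens_addA tens_addC tens_add0 tens_addN.

Lemma mktensD s t : mktens s + mktens t = mktens (s ++ t).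
Proof. exact: tens_addE. Qed.

Definition tens_scale (f : A) : tens -> tens := tens_mapl ( *%R f).

Lemma tens_scaleE f s : tens_scale f (mktens s) = mktens [seq (f * p.1, p.2) | p <- s].
Proof. by apply: tens_maplE => [a b|c a]; rewrite ?mulrDr ?scalerAr. Qed.

Fact tens_scaleA f g u : tens_scale f (tens_scale g u) = tens_scale (f * g) u.
Proof.
elim/tens_ind: u => s; rewrite !tens_scaleE -map_comp; congr mktens.
by apply: eq_map => p /=; rewrite mulrA.
Qed.

Fact tens_scale1 : left_id 1 tens_scale.
Proof.
elim/tens_ind=> s; rewrite tens_scaleE; congr mktens.
by rewrite -[RHS]map_id; apply: eq_map => -[a w] /=; rewrite mul1r.
Qed.

Fact tens_scaleDr : right_distributive tens_scale +%R.
Proof.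
by move=> f; elim/tens_ind=> s; elim/tens_ind=> t;
   rewrite mktensD !tens_scaleE map_cat mktensD.
Qed.

Fact tens_scaleDl u : {morph tens_scale^~ u : f g / f + g}.
Proof.
move=> f g; elim/tens_ind: u => s; rewrite !tens_scaleE mktensD; apply/mktensP.
elim: s => [|[a w] s IH] /=; first exact: tens_refl.
set s1 := map _ s in IH *; set s2 := map _ s in IH *; set s3 := map _ s in IH *.
apply: (tens_trans (t := [:: (f * a, w); (g * a, w)] ++ (s2 ++ s3))).
  rewrite -[_ :: _]/([:: ((f + g) * a, w)] ++ s1).
  by apply: tens_cat => //; rewrite mulrDl; apply: tens_addl.
rewrite -[[:: _; _] ++ _]/([:: (f * a, w)] ++ ([:: (g * a, w)] ++ s2 ++ s3)).
rewrite -[_ :: _ ++ _]/([:: (f * a, w)] ++ (s2 ++ [:: (g * a, w)] ++ s3)).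
apply: tens_cat; first exact: tens_refl.
by rewrite !catA; apply: tens_cat; [apply: tens_catC | apply: tens_refl].
Qed.

HB.instance Definition _ := GRing.Zmodule_isLmodule.Build A tens
  tens_scaleA tens_scale1 tens_scaleDr tens_scaleDl.

Definition tmul (a : A) (w : W) : tens := mktens [:: (a, w)].

Lemma tmulDl w : {morph tmul^~ w : a b / a + b}.
Proof. by move=> a b; rewrite mktensD; apply/mktensP/tens_addl. Qed.

Lemma tmulDr a : {morph tmul a : v w / v + w}.
Proof. by move=> v w; rewrite mktensD; apply/mktensP/tens_addr. Qed.

Lemma tmul_bal c a w : tmul (c *: a) w = tmul a (c *: w).
Proof. exact/mktensP/tens_bal. Qed.

Lemma tmulZ (f a : A) w : f *: tmul a w = tmul (f * a) w.
Proof. exact: tens_scaleE. Qed.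

Lemma mktens_sum s : mktens s = \sum_(p <- s) tmul p.1 p.2.
Proof.
elim: s => [|[a w] s IH]; first by rewrite big_nil.
by rewrite big_cons -IH /tmul mktensD.
Qed.

Lemma tmul0r a : tmul a 0 = 0.
Proof. by apply: (addrI (tmul a 0)); rewrite -tmulDr !addr0. Qed.

Lemma tmul_sumr (I : Type) (r : seq I) a (v : I -> W) :
  tmul a (\sum_(i <- r) v i) = \sum_(i <- r) tmul a (v i).
Proof. by apply: (big_morph (tmul a)); [exact: tmulDr | exact: tmul0r]. Qed.

End Tensor.

Section Euler.
Variables (R : comNzRingType) (W : lmodType R) (B : {linear W -> W}).

Definition euler_seq (s : seq (fps R * W)) : seq (fps R * W) :=
  flatten [seq [:: (fps_theta p.1, p.2); (p.1, B p.2)] | p <- s].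

Definition euler_map (u : tens (fps R) W) : tens (fps R) W :=
  mktens (euler_seq (repr u)).

Lemma mktens_euler s : mktens (euler_seq s) =
  \sum_(p <- s) (tmul (fps_theta p.1) p.2 + tmul p.1 (B p.2)).
Proof.
elim: s => [|[f w] s IH]; first by rewrite big_nil.
by rewrite big_cons -IH /tmul !mktensD.
Qed.

Lemma euler_map_mktens s : euler_map (mktens s) = mktens (euler_seq s).
Proof.
rewrite /euler_map !mktens_euler; move: (repr_mktens s); move: (repr _) => t.
have tmul0l w : tmul 0 w = 0 :> tens (fps R) W.
  by rewrite -(scale0r 0) tmul_bal scale0r tmul0r.
elim=> {s t} [s|s t _|s t u _ -> _|s s' t t' _ IH1 _ IH2|s t|w|f g w|f v w|c f w] //=.
- by rewrite !big_cat /= IH1 IH2.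
- by rewrite !big_cat /= addrC.
- rewrite big_nil big_seq1 /= tmul0l (_ : fps_theta 0 = 0) ?tmul0l ?addr0 //.
  by rewrite -(scale0r (0 : fps R)) fps_thetaZ !scale0r.
- by rewrite !big_cons !big_nil /= fps_thetaD !tmulDl !addr0 addrACA.
- by rewrite !big_cons !big_nil /= linearD !tmulDr !addr0 addrACA.
- by rewrite !big_seq1 /= fps_thetaZ !tmul_bal linearZ.
Qed.

Lemma euler_mapE f w :
  euler_map (tmul f w) = tmul (fps_theta f) w + tmul f (B w).
Proof. by rewrite euler_map_mktens mktens_euler big_seq1. Qed.

Fact euler_mapD : {morph euler_map : u v / u + v}.
Proof.
elim/tens_ind=> s; elim/tens_ind=> t.
by rewrite mktensD !euler_map_mktens !mktens_euler big_cat.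
Qed.

Fact euler_leibniz (f : fps R) (u : tens (fps R) W) :
  euler_map (f *: u) = fps_theta f *: u + f *: euler_map u.
Proof.
elim/tens_ind: u => s; elim: s => [|[g w] s IH].
  have z : euler_map 0 = 0 by rewrite euler_map_mktens mktens_euler big_nil.
  by rewrite -[mktens [::]]/(0 : tens (fps R) W) !scaler0 z scaler0 addr0.
have -> : mktens ((g, w) :: s) = tmul g w + mktens s by rewrite mktensD.
rewrite scalerDr !euler_mapD IH !scalerDr tmulZ !euler_mapE scalerDr !tmulZ.
rewrite fps_thetaM tmulDl -!addrA; congr (_ + _).
by rewrite [RHS]addrCA; congr (_ + _); rewrite [RHS]addrCA.
Qed.

Fact euler_linear (a : R) (u v : tens (fps R) W) :
  euler_map (GRing.in_alg (fps R) a *: u + v) =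
  GRing.in_alg (fps R) a *: euler_map u + euler_map v.
Proof.
rewrite euler_mapD euler_leibniz /= fps_thetaZ.
by rewrite -[1 : fps R](expr0 fpsX) fps_thetaXn mulr0n scaler0 scale0r add0r.
Qed.

Fact euler_fg : fin_gen W -> fin_gen (tens (fps R) W).
Proof.
move=> [n [e eP]]; exists n, (fun i => tmul 1 (e i)); elim/tens_ind=> s.
elim: s => [|[f w] s [c IH]].
  by exists (fun=> 0); rewrite big1 // => i _; rewrite scale0r.
have [d ->] := eP w; exists (fun i => d i *: f + c i).
rewrite [RHS](eq_bigr (fun i => (d i *: f) *: tmul 1 (e i) + c i *: tmul 1 (e i)));
  last by move=> i _; rewrite scalerDl.
rewrite big_split -IH /= -[mktens (_ :: _)]/(mktens ([:: (f, _)] ++ s)) -mktensD.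
congr (_ + _); rewrite -/(tmul _ _) tmul_sumr; apply: eq_bigr => i _.
by rewrite tmulZ mulr1 tmul_bal.
Qed.

Definition eul (Wfg : fin_gen W) : MC_log R :=
  Connection (euler_fg Wfg) euler_linear euler_leibniz.

End Euler.

Section Ideals.
Variable R : comNzRingType.
Local Open Scope classical_set_scope.
Implicit Types I J : set R.

Definition is_ideal I : Prop :=
  [/\ I 0, (forall a b, I a -> I b -> I (a + b)) & (forall c a, I a -> I (c * a))].

Definition is_maximal_ideal I : Prop :=
  [/\ is_ideal I, I != setT & forall J, is_ideal J -> I `<=` J -> J = I \/ J = setT].

Definition is_local (r : set R) : Prop :=
  is_maximal_ideal r /\ forall J, is_maximal_ideal J -> J = r.

Definition is_noetherian : Prop :=
  forall I, is_ideal I -> exists (n : nat) (e : 'I_n -> R),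
    I = [set a | exists c : 'I_n -> R, a = \sum_i c i * e i].

(* The submodule I W generated by the products a w. *)
Definition ideal_smul I (W : lmodType R) : set W :=
  [set w | exists (n : nat) (a : 'I_n -> R) (u : 'I_n -> W),
     (forall i, I (a i)) /\ w = \sum_i a i *: u i].

Fixpoint ideal_pow I (n : nat) : set R :=
  if n is m.+1 then
    [set b | exists (k : nat) (a c : 'I_k -> R),
       (forall i, I (a i) /\ ideal_pow I m (c i)) /\ b = \sum_i a i * c i]
  else setT.

(* R -> lim_n R / I^n is bijective. *)
Definition is_adic_complete I : Prop :=
  forall u : nat -> R, (forall n, ideal_pow I n (u n.+1 - u n)) ->
    exists! a, forall n, ideal_pow I n (a - u n).

End Ideals.

Section ResidueField.
Variables (C : fieldType) (R : comUnitAlgType C) (r : set R).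

(* The composite C -> R -> R / r is bijective. *)
Definition has_residue_field : Prop :=
  forall a : R, exists! c : C, r (a - c%:A).

Definition residue (a : R) : C := xget 0 [set c | r (a - c%:A)]%classic.

End ResidueField.

(* The natural map tau -> C / Z is bijective. *)
Definition is_transversal_mod_int (C : fieldType) (tau : set C) : Prop :=
  forall c : C, exists! t, tau t /\ exists z : int, c - t = z%:~R.

Section Reduction.
Variables (R : comNzRingType) (I : set R) (W : lmodType R).

Definition ideal_smul_pred : {pred W} := fun w => `[< ideal_smul I w >].

Fact ideal_smul_submod : submod_closed ideal_smul_pred.
Proof.
split=> [|c v w /asboolP[n [a [x [Ia ->]]]] /asboolP[m [b [y [Ib ->]]]]].
  apply/asboolP; exists 0%N, (fun=> 0), (fun=> 0).
  by split=> [[]//|]; rewrite big_ord0.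
apply/asboolP; exists (n + m)%N.
exists (fun i => match fintype.split i with inl j => a j | inr j => b j end).
exists (fun i => match fintype.split i with inl j => c *: x j | inr j => y j end).
split=> [i|]; first by case: fintype.split.
rewrite big_split_ord scaler_sumr; congr (_ + _); apply: eq_bigr => i _.
  by rewrite (unsplitK (inl i)) !scalerA mulrC.
by rewrite (unsplitK (inr i)).
Qed.

HB.instance Definition _ :=
  GRing.isZmodClosed.Build W ideal_smul_pred (GRing.submod_closedB ideal_smul_submod).

Definition modquot := @Quotient.quot W ideal_smul_pred.

HB.instance Definition _ := GRing.Zmodule.on modquot.

Definition mq_pi (w : W) : modquot := \pi_modquot w.

Lemma mq_piP v w : mq_pi v = mq_pi w <-> ideal_smul I (v - w).
Proof.
have E : ((v - w) \in ideal_smul_pred) = (mq_pi v == mq_pi w).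
  exact: (@Quotient.idealrBE W ideal_smul_pred).
by split=> [/eqP|H]; [rewrite -E => /asboolP | apply/eqP; rewrite -E; apply/asboolP].
Qed.

Lemma mq_ind (P : modquot -> Prop) : (forall w, P (mq_pi w)) -> forall u, P u.
Proof. by move=> H u; rewrite -[u]reprK; apply: H. Qed.

Lemma mq_repr w : ideal_smul I (repr (mq_pi w) - w).
Proof. by apply/mq_piP; rewrite /mq_pi reprK. Qed.

Lemma mq_piD : {morph mq_pi : v w / v + w}.
Proof. exact: (@Quotient.pi_add W ideal_smul_pred). Qed.

Lemma ideal_smul_linear (B : {linear W -> W}) w :
  ideal_smul I w -> ideal_smul I (B w).
Proof.
move=> [n [a [x [Ia ->]]]]; exists n, a, (B \o x); split=> //.
by rewrite linear_sum; apply: eq_bigr => i _; rewrite linearZ.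
Qed.

Definition mq_scale (c : R) (u : modquot) : modquot := mq_pi (c *: repr u).

Lemma mq_piZ c w : mq_scale c (mq_pi w) = mq_pi (c *: w).
Proof.
by apply/mq_piP; rewrite -scalerBr; apply/(ideal_smul_linear (c \*: idfun))/mq_repr.
Qed.

Fact mq_scaleA c d u : mq_scale c (mq_scale d u) = mq_scale (c * d) u.
Proof. by elim/mq_ind: u => w; rewrite !mq_piZ scalerA. Qed.

Fact mq_scale1 : left_id 1 mq_scale.
Proof. by elim/mq_ind=> w; rewrite mq_piZ scale1r. Qed.

Fact mq_scaleDr : right_distributive mq_scale +%R.
Proof.
move=> c; elim/mq_ind=> v; elim/mq_ind=> w.
by rewrite -mq_piD !mq_piZ scalerDr mq_piD.
Qed.

Fact mq_scaleDl u : {morph mq_scale^~ u : c d / c + d}.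
Proof.
by move=> c d; elim/mq_ind: u => w; rewrite !mq_piZ scalerDl mq_piD.
Qed.

HB.instance Definition _ := GRing.Zmodule_isLmodule.Build R modquot
  mq_scaleA mq_scale1 mq_scaleDr mq_scaleDl.

Definition mq_map (B : {linear W -> W}) (u : modquot) : modquot :=
  mq_pi (B (repr u)).

Lemma mq_mapE (B : {linear W -> W}) w : mq_map B (mq_pi w) = mq_pi (B w).
Proof.
by apply/mq_piP; rewrite -linearB; apply/ideal_smul_linear/mq_repr.
Qed.

End Reduction.

(* W / r W is a vector space over C by restriction of scalars along C -> R. *)
Definition reduction_eigenvalue (C : fieldType) (R : comUnitAlgType C)
    (r : set R) (W : lmodType R) (B : {linear W -> W}) (lambda : C) : Prop :=
  exists2 u : modquot r W, u <> 0 & mq_map B u = lambda%:A *: u.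

(* Substituting y = P z in theta y = A y yields
   theta z = P^-1 (A P - theta P) z. *)
Definition gauge_transform (R : comNzRingType) (n : nat) (P A : 'M[laurent R]_n) :
    'M[laurent R]_n :=
  invmx P *m (A *m P - map_mx (@lau_theta R) P).

(* Main.v *)
From HB Require Import structures.
Require Import Defs.
From mathcomp Require Import all_boot all_algebra.
From mathcomp Require Import zify boolp classical_sets cardinality.

Set Implicit Arguments.
Unset Strict Implicit.
Unset Printing Implicit Defensive.

Import GRing.Theory.
Local Open Scope ring_scope.

(** Both halves of the theorem come from one statement about a matrix [A] over
    R[[x]], [tau_normal_form]: some [P] in GL_n(R((x))) satisfies
    A P + theta P = P B with [B] constant and the spectrum of [B] modulo the
    maximal ideal contained in tau. Such a [P] is a change of basis for the
    connection of matrix [A]; the differential system theta y = A y carries the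
    opposite sign, so it is treated by applying the statement to [- A] and to
    - tau, again a transversal of C / Z.

    If no two eigenvalues of the reduction of A(0) differ by a positive integer,
    [P] can be found with P(0) = 1 and B = A(0): the coefficient of x^k asks
    for the solution of a Sylvester equation (A(0) + k) P_k - P_k A(0) = ... .
    This operator is invertible over R because its determinant is a unit: its
    reduction over C is injective, A(0) + k and A(0) having no common eigenvalue
    there ([sylvester_inverse], [fps_gauge_nonresonant]). Eigenvalues in tau
    satisfy the condition.

    It remains to move the eigenvalues into tau. A scalar gauge x^-N first
    brings each of them to some t - k with t in tau and k >= 0. Then the gauge
    diag(x, 1) adds 1 to a first group of eigenvalues, those outside tau, and
    this is repeated ([fps_gauge_raise], [fps_gauge_into_tau]). The conjugate by
    diag(x, 1) has no pole only if the upper right block of A(0) vanishes over R,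
    not merely modulo the maximal ideal. The splitting into generalized
    eigenspaces gives the vanishing modulo the maximal ideal; conjugating by a
    unipotent matrix with off-diagonal block Y makes it exact as soon as Y solves
    the Riccati equation a Y - Y d = Y c Y - b. As b is small and the Sylvester
    operator on the left is invertible, Y is the limit of a sequence that is
    Cauchy for the adic topology ([riccati], [block_triangularize]).

    To return to modules, a free module of finite type has a finite basis, a
    connection becomes a matrix, and two connections with gauge equivalent
    matrices are isomorphic ([gauge_conn_iso]). Localization and the Euler
    construction have evident bases with evident matrices
    ([loc_connection_matrix], [euler_connection_matrix]). *)

(** * Sylvester operators and spectral splitting over a field *)

Definition spectra_disjoint (F : fieldType) p q (a : 'M[F]_p) (d : 'M[F]_q) :=
  forall z, eigenvalue a z -> ~~ eigenvalue d z.

(** [X] intertwines f(a) and f(d) for each polynomial f. Taking for f the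
    characteristic polynomial of [d] kills the side of [d], while f(a) is
    invertible by Bezout. *)
Lemma sylvester_field_inj (F : closedFieldType) p q (a : 'M[F]_p) (d : 'M[F]_q)
    (X : 'M[F]_(p, q)) :
  spectra_disjoint a d -> a *m X = X *m d -> X = 0.
Proof.
case: p => [|p] in a X *; first by move=> _ _; apply: flatmx0.
case: q => [|q] in d X *; first by move=> _ _; apply: thinmx0.
move=> ad aX.
have hX f : horner_mx a f *m X = X *m horner_mx d f.
  elim/poly_ind: f => [|f c IH]; first by rewrite !rmorph0 mul0mx mulmx0.
  rewrite !rmorphD !rmorphM /= !horner_mx_X !horner_mx_C mulmxDl mulmxDr.
  by rewrite -!mulmxA aX !mulmxA IH mul_scalar_mx mul_mx_scalar.
have /Bezout_eq1_coprimepP[[u v] /= uv] : coprimep (char_poly a) (char_poly d).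
  apply/coprimepP=> f fa fd; rewrite -size_poly_eq1; apply/closed_rootP => -[z fz].
  have fz' m : f %| m -> 'X - z%:P %| m.
    by apply: dvdp_trans; rewrite dvdp_XsubCl.
  have := ad z; rewrite !eigenvalue_root_char -!dvdp_XsubCl !fz' //.
  by move/(_ isT).
have := congr1 (fun f => horner_mx a f *m X) uv.
rewrite rmorphD !rmorphM /= rmorph1 Cayley_Hamilton mulr0 add0r mul1mx => <-.
by rewrite -mulmxA hX Cayley_Hamilton mulmx0 mulmx0.
Qed.

Lemma kermxpoly_char (F : fieldType) n (A : 'M[F]_n) :
  (kermxpoly A (char_poly A) :=: 1%:M)%MS.
Proof.
case: n => [|n] in A *; last exact/kermxpoly_min/mxminpoly_dvd_char.
by rewrite [1%:M]thinmx0 [kermxpoly _ _]thinmx0.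
Qed.

(** The characteristic polynomial is the product of its linear factors with root
    in [Q] and of the others, two coprime polynomials; the rows of [g] are bases
    of their two kernels. The dimension [n] is only propositionally [p + q],
    whence the cast. *)
Lemma spectral_split (F : closedFieldType) n (A : 'M[F]_n) (Q : pred F) :
  exists p q (e : (n = p + q)%N) (g : 'M[F]_(p + q)) (a : 'M_p) (d : 'M_q),
  [/\ g \in unitmx,
      g *m castmx (e, e) A = block_mx a 0 0 d *m g,
      forall z, eigenvalue a z -> eigenvalue A z && Q z &
      forall z, eigenvalue d z -> eigenvalue A z && ~~ Q z].
Proof.
have [s sA] := closed_field_poly_normal (char_poly A).
move: sA; rewrite (monicP (char_poly_monic A)) scale1r => sA.
pose f (P : pred F) := \prod_(z <- s | P z) ('X - z%:P).
have rootf P z : root (f P) z -> P z.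
  rewrite /f -big_filter root_prod_XsubC mem_filter; by case/andP.
pose V P := kermxpoly A (f P); pose U P := row_base (V P).
have VA P : (V P *m A <= V P)%MS by apply/comm_mx_stable_kermxpoly.
have UA P : exists a, U P *m A = a *m U P.
  apply/submxP; rewrite (submx_trans _ (_ : (V P *m A <= _)%MS)) //.
    by rewrite submxMr // eq_row_base.
  by rewrite (submx_trans (VA P)) // eq_row_base.
have Ueig P a z : U P *m A = a *m U P -> eigenvalue a z -> eigenvalue A z && P z.
  move=> aU /eigenvalueP[v va v0].
  have vU : v *m U P != 0.
    apply: contra v0 => /eqP v0; apply/eqP/(row_free_inj (row_base_free (V P))).
    by rewrite mul0mx.
  have eA : (v *m U P) *m A = z *: (v *m U P).
    by rewrite -mulmxA aU mulmxA va scalemxAl.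
  apply/andP; split; first by apply/eigenvalueP; exists (v *m U P).
  apply: contraR vU => Pz; rewrite -submx0.
  have <- : (V P :&: kermxpoly A ('X - z%:P) = 0)%MS.
    rewrite mxdirect_kermxpoly // coprimep_XsubC.
    by apply: contra Pz => /rootf.
  rewrite sub_capmx -eigenspace_poly; apply/andP; split; last exact/eigenspaceP.
  by rewrite (submx_trans (submxMl _ _)) // eq_row_base.
have cop : coprimep (f Q) (f (predC Q)).
  apply/coprimepP=> h h1 h2; rewrite -size_poly_eq1; apply/closed_rootP => -[z hz].
  have hz' m : h %| m -> 'X - z%:P %| m.
    by apply: dvdp_trans; rewrite dvdp_XsubCl.
  have /rootf Qz : root (f Q) z by rewrite -dvdp_XsubCl hz'.
  by have /rootf/negP : root (f (predC Q)) z by rewrite -dvdp_XsubCl hz'.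
have full : (V Q + V (predC Q) :=: 1%:M)%MS.
  apply: eqmx_trans (eqmx_sym (kermxpolyM A cop)) _.
  have -> : f Q * f (predC Q) = char_poly A by rewrite sA [RHS](bigID Q).
  exact: kermxpoly_char.
have dim : (\rank (V Q) + \rank (V (predC Q)) = n)%N.
  have := mxrank_sum_cap (V Q) (V (predC Q)).
  by rewrite mxdirect_kermxpoly // mxrank0 addn0 full mxrank1 => <-.
have [a aU] := UA Q; have [d dU] := UA (predC Q).
exists (\rank (V Q)), (\rank (V (predC Q))), (esym dim).
pose g := col_mx (U Q) (U (predC Q)).
have gA : g *m A = block_mx a 0 0 d *m g.
  by rewrite mul_col_mx mul_block_col !mul0mx addr0 add0r aU dU.
have gF : row_full g.
  by rewrite -sub1mx -full -addsmxE addsmxS // eq_row_base.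
have cast m (e : n = m) (h : 'M[F]_(m, n)) T : row_full h -> h *m A = T *m h ->
  castmx (erefl, e) h \in unitmx /\
  castmx (erefl, e) h *m castmx (e, e) A = T *m castmx (erefl, e) h.
  by case: m / e h T => h T; rewrite !castmx_id -row_full_unit.
have [gU gE] := cast _ (esym dim) _ _ gF gA.
exists (castmx (erefl, esym dim) g), a, d; split=> //.
- by move=> z; apply: Ueig aU.
- by move=> z; apply: Ueig dU.
Qed.

(** * Adic limits *)

Section AdicTopology.
Variables (R : comNzRingType) (I : set R).
Hypothesis idI : is_ideal I.

Lemma ideal_pow_ideal n : is_ideal (ideal_pow I n).
Proof.
elim: n => [|n [_ _ IHZ]] //=; split.
- by exists 0%N, (fun=> 0), (fun=> 0); split=> [[]//|]; rewrite big_ord0.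
- move=> _ _ [k [a [c [ac ->]]]] [l [b [d [bd ->]]]]; exists (k + l)%N.
  exists (fun i => match fintype.split i with inl j => a j | inr j => b j end).
  exists (fun i => match fintype.split i with inl j => c j | inr j => d j end).
  split=> [i|]; first by case: fintype.split.
  rewrite big_split_ord; congr (_ + _); apply: eq_bigr => i _.
    by rewrite (unsplitK (inl i)).
  by rewrite (unsplitK (inr i)).
- move=> x _ [k [a [c [ac ->]]]]; exists k, a, (fun i => x * c i).
  split=> [i|]; first by have [? ?] := ac i; split=> //; apply: IHZ.
  by rewrite mulr_sumr; apply: eq_bigr => i _; rewrite mulrCA.
Qed.

Lemma ideal_powM n a b : I a -> ideal_pow I n b -> ideal_pow I n.+1 (a * b).
Proof. by move=> Ia Ib; exists 1%N, (fun=> a), (fun=> b); rewrite big_ord1. Qed.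

Lemma ideal_sum J m (a : 'I_m -> R) :
  is_ideal J -> (forall i, J (a i)) -> J (\sum_i a i).
Proof. by move=> [J0 JD _] Ja; elim/big_ind: _. Qed.

Lemma ideal_powS n a : ideal_pow I n.+1 a -> ideal_pow I n a.
Proof.
move=> [k [b [c [bc ->]]]]; have idn := ideal_pow_ideal n.
apply: (ideal_sum idn) => i; have [_ _ JZ] := idn.
by apply: JZ; case: (bc i).
Qed.

Lemma ideal_pow1 a : ideal_pow I 1 a -> I a.
Proof.
move=> [k [b [c [bc ->]]]]; apply: (ideal_sum idI) => i.
by have [_ _ JZ] := idI; rewrite mulrC; apply: JZ; case: (bc i).
Qed.

Hypothesis cI : is_adic_complete I.

Lemma adic_separated a : (forall n, ideal_pow I n a) -> a = 0.
Proof.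
move=> Ia; have idn := ideal_pow_ideal.
have [|b [_ bU]] := cI (u := fun=> 0).
  by move=> n; rewrite subrr; case: (idn n).
rewrite -(bU a); first by apply: bU => n; rewrite subr0; case: (idn n).
by move=> n; rewrite subr0.
Qed.

Lemma adic_limit (u : nat -> R) :
  (forall n, ideal_pow I n (u n.+1 - u n)) ->
  exists a, forall n, ideal_pow I n (a - u n).
Proof. by move=> /cI[a [aP _]]; exists a. Qed.

(** The inverse is the sum of the geometric series of [y]. *)
Lemma geometric_inverse y : I y -> exists b, (1 - y) * b = 1.
Proof.
move=> Iy; pose u n := \sum_(i < n) y ^+ i.
have Iyn n : ideal_pow I n (y ^+ n).
  by elim: n => //= n IH; rewrite exprS; apply: (ideal_powM Iy IH).
have [|b bu] := adic_limit (u := u).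
  by move=> n; rewrite /u big_ord_recr /= addrAC subrr add0r.
exists b; apply/eqP; rewrite -subr_eq0; apply/eqP/adic_separated => n.
have -> : (1 - y) * b - 1 = (1 - y) * (b - u n) - y ^+ n.
  by rewrite mulrBr -[1 - y in X in _ = _ - X - _]opprB mulNr -subrX1 opprB opprB
    addrA addrAC addrK.
have [_ JD JZ] := ideal_pow_ideal n.
by apply: JD; [apply/JZ/bu | rewrite -mulN1r; apply/JZ/Iyn].
Qed.

Definition mx_in (J : set R) p q (M : 'M[R]_(p, q)) := forall i j, J (M i j).

Section MxIn.
Variable J : set R.
Hypothesis idJ : is_ideal J.

Lemma mx_in0 p q : mx_in J (0 : 'M_(p, q)).
Proof. by move=> i j; rewrite mxE; case: idJ. Qed.

Lemma mx_inD p q (M N : 'M_(p, q)) : mx_in J M -> mx_in J N -> mx_in J (M + N).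
Proof. by move=> JM JN i j; rewrite mxE; case: idJ => _ JD _; apply: JD. Qed.

Lemma mx_inN p q (M : 'M_(p, q)) : mx_in J M -> mx_in J (- M).
Proof.
by move=> JM i j; rewrite mxE -mulN1r; case: idJ => _ _ JZ; apply: JZ.
Qed.

Lemma mx_inB p q (M N : 'M_(p, q)) : mx_in J M -> mx_in J N -> mx_in J (M - N).
Proof. by move=> JM JN; apply: mx_inD => //; apply: mx_inN. Qed.

Lemma mx_in_mull p q s (L : 'M_(p, q)) (M : 'M_(q, s)) :
  mx_in J M -> mx_in J (L *m M).
Proof.
move=> JM i j; rewrite mxE; apply: ideal_sum => // k.
by case: idJ => _ _ JZ; apply: JZ.
Qed.

Lemma mx_in_mulr p q s (M : 'M_(p, q)) (L : 'M_(q, s)) :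
  mx_in J M -> mx_in J (M *m L).
Proof.
move=> JM i j; rewrite mxE; apply: ideal_sum => // k.
by rewrite mulrC; case: idJ => _ _ JZ; apply: JZ.
Qed.

End MxIn.

Lemma mx_in_powM n p q s (M : 'M_(p, q)) (N : 'M_(q, s)) :
  mx_in I M -> mx_in (ideal_pow I n) N -> mx_in (ideal_pow I n.+1) (M *m N).
Proof.
move=> JM JN i j; rewrite mxE; apply: (ideal_sum (ideal_pow_ideal n.+1)) => k.
exact: ideal_powM.
Qed.

Lemma mx_in_powMr n p q s (M : 'M_(p, q)) (N : 'M_(q, s)) :
  mx_in (ideal_pow I n) M -> mx_in I N -> mx_in (ideal_pow I n.+1) (M *m N).
Proof.
move=> JM JN i j; rewrite mxE; apply: (ideal_sum (ideal_pow_ideal n.+1)) => k.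
by rewrite mulrC; apply: ideal_powM.
Qed.

Lemma mx_adic_limit p q (u : nat -> 'M[R]_(p, q)) :
  (forall n, mx_in (ideal_pow I n) (u n.+1 - u n)) ->
  exists a, forall n, mx_in (ideal_pow I n) (a - u n).
Proof.
move=> Cu.
have /choice[a aP] (ij : 'I_p * 'I_q) :
    exists a, forall n, ideal_pow I n (a - u n ij.1 ij.2).
  by apply: adic_limit => n; have := Cu n ij.1 ij.2; rewrite !mxE.
by exists (\matrix_(i, j) a (i, j)) => n i j; rewrite !mxE; apply: (aP (i, j)).
Qed.

Lemma mx_adic_separated p q (M : 'M[R]_(p, q)) :
  (forall n, mx_in (ideal_pow I n) M) -> M = 0.
Proof.
by move=> JM; apply/matrixP=> i j; rewrite mxE; apply: adic_separated => n; apply: JM.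
Qed.

(** Fixed point of Y = S (Y c Y - b), where [S] is a right inverse of [L]. The
    quadratic map is contracting on matrices with entries in [I]: as
    X c X - Y c Y = X c (X - Y) + (X - Y) c Y, a difference in I^n is sent into
    I^(n+1). The hypotheses on [S] and [L] say that they do not lose this
    precision, as is the case for maps that are linear over [R]. *)
Lemma riccati p q (S : {additive 'M[R]_(p, q) -> 'M[R]_(p, q)})
    (L : {additive 'M[R]_(p, q) -> 'M[R]_(p, q)})
    (b : 'M[R]_(p, q)) (c : 'M[R]_(q, p)) :
    (forall J X, is_ideal J -> mx_in J X -> mx_in J (S X)) ->
    (forall J X, is_ideal J -> mx_in J X -> mx_in J (L X)) ->
    cancel S L -> mx_in I b ->
  exists2 Y, mx_in I Y & L Y = Y *m c *m Y - b.
Proof.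
move=> SJ LJ SK Ib; pose u n := iter n (fun Y => S (Y *m c *m Y - b)) 0.
have Iu n : mx_in I (u n).
  elim: n => [|n IH] /=; first exact: mx_in0.
  by apply: SJ => //; apply: mx_inB => //; apply: mx_in_mull.
have dif (n : nat) (X Y : 'M_(p, q)) : mx_in I X -> mx_in I Y ->
    mx_in (ideal_pow I n) (X - Y) ->
  mx_in (ideal_pow I n.+1) (X *m c *m X - Y *m c *m Y).
  move=> IX IY XY; have idn := ideal_pow_ideal n.+1.
  have -> : X *m c *m X - Y *m c *m Y = X *m c *m (X - Y) + (X - Y) *m (c *m Y).
    by rewrite mulmxBr mulmxBl !mulmxA addrA subrK.
  apply: (mx_inD idn); last by apply: mx_in_powMr => //; apply: mx_in_mull.
  by apply: mx_in_powM => //; apply: mx_in_mulr.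
have [|Y Yu] := mx_adic_limit (u := u).
  elim=> [//|n IH] /=; rewrite -/(u n) -raddfB opprB addrA subrK.
  by apply: SJ (ideal_pow_ideal n.+1) _; apply: dif => //; apply: Iu n.+1.
have IY : mx_in I Y.
  rewrite -(subrK (u 1%N) Y); apply: (mx_inD idI) => // i j.
  by apply: ideal_pow1; apply: Yu.
exists Y => //; apply/eqP; rewrite -subr_eq0; apply/eqP/mx_adic_separated => n.
have -> : L Y - (Y *m c *m Y - b) =
    L (Y - u n.+1) - (Y *m c *m Y - u n *m c *m u n).
  have -> : L (Y - u n.+1) = L Y - (u n *m c *m u n - b).
    by rewrite (raddfB L) -[u n.+1]/(S (u n *m c *m u n - b)) SK.
  by rewrite -!addrA; congr (_ + _); rewrite !opprB addrA subrK.
have idn := ideal_pow_ideal n.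
apply: (mx_inB idn) => [|i j]; last by apply: ideal_powS; apply: dif.
by apply: (LJ _ _ idn) => i j; apply: ideal_powS; apply: Yu.
Qed.

End AdicTopology.

(** * Block triangularization over a complete local ring *)

Definition sylvester (R : comNzRingType) p q (a : 'M[R]_p) (d : 'M[R]_q)
  : {linear 'M[R]_(p, q) -> 'M[R]_(p, q)} := mulmx a \- mulmxr d.

Lemma sylvesterE (R : comNzRingType) p q (a : 'M[R]_p) (d : 'M[R]_q) X :
  sylvester a d X = a *m X - X *m d.
Proof. by []. Qed.

Lemma mxvec_in (R : comNzRingType) (J : set R) p q (X : 'M[R]_(p, q)) :
  mx_in J X -> mx_in J (mxvec X).
Proof. by move=> JX i k; case/mxvec_indexP: k => k l; rewrite ord1 mxvecE. Qed.

Lemma vec_mx_in (R : comNzRingType) (J : set R) p q (u : 'rV[R]_(p * q)) :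
  mx_in J u -> mx_in J (vec_mx u).
Proof. by move=> Ju i j; rewrite mxE. Qed.

(** A complete local algebra with residue field [C] is presented by the reduction
    morphism [rho], a retraction of the structure map whose kernel is the maximal
    ideal. *)
Section CompleteLocal.
Variables (C : closedFieldType) (R : comUnitAlgType C) (rho : {rmorphism R -> C}).
Local Notation I := [set a | rho a = 0]%classic.
Hypothesis rhoC : forall c, rho c%:A = c.
Hypothesis cI : is_adic_complete I.

Lemma ker_ideal : is_ideal I.
Proof.
split=> /= [|a b a0 b0|c a a0]; first exact: rmorph0.
  by rewrite rmorphD a0 b0 addr0.
by rewrite rmorphM a0 mulr0.
Qed.

(** Dividing by the constant [rho a] reduces to an element of 1 + ker rho. *)
Lemma residue_unit a : rho a != 0 -> a \is a GRing.unit.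
Proof.
move=> a0; have [|b ab] := geometric_inverse cI (y := 1 - (rho a)^-1 *: a).
  by rewrite /= -mulr_algl rmorphB rmorph1 rmorphM rhoC mulVf // subrr.
apply/unitrP; exists ((rho a)^-1 *: b).
by move: ab; rewrite subKr -!scalerAl -scalerAr [b * a]mulrC.
Qed.

Lemma residue_unitmx n (M : 'M[R]_n) : map_mx rho M \in unitmx -> M \in unitmx.
Proof. by rewrite !unitmxE det_map_mx unitfE; apply: residue_unit. Qed.

(** The determinant of the operator reduces to that of the Sylvester operator
    over [C], which is injective. The inverse being linear, it preserves the
    matrices with entries in a given ideal, as the Riccati iteration requires. *)
Lemma sylvester_inverse p q (a : 'M[R]_p) (d : 'M[R]_q) :
    spectra_disjoint (map_mx rho a) (map_mx rho d) ->
  exists2 S : {linear 'M[R]_(p, q) -> 'M[R]_(p, q)},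
    cancel S (sylvester a d) &
    forall J X, is_ideal J -> mx_in J X -> mx_in J (S X).
Proof.
move=> ad; pose N := lin_mx (sylvester a d).
have uN : N \in unitmx.
  apply: residue_unitmx.
  have -> : map_mx rho N = lin_mx (sylvester (map_mx rho a) (map_mx rho d)).
    by apply: map_lin_mx => X; rewrite map_mxB !map_mxM.
  rewrite -row_free_unit; apply: inj_row_free => v v0.
  rewrite -[v]vec_mxK (sylvester_field_inj (X := vec_mx v) ad) ?linear0 //.
  by apply/eqP; rewrite -subr_eq0 -sylvesterE -mx_rV_lin v0 linear0.
exists (vec_mx \o mulmxr (invmx N) \o mxvec : {linear _ -> _}) => [X|J X idJ JX].
  rewrite -[LHS]/(sylvester a d (vec_mx (mxvec X *m invmx N))).
  by rewrite -mx_rV_lin mulmxKV // mxvecK.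
by apply: vec_mx_in; apply: mx_in_mulr => //; apply: mxvec_in.
Qed.

(** The upper right block of the conjugate of [A] by block_mx 1 Y 0 1 is
    a Y + b - Y c Y - Y d, so that [Y] has to solve a Riccati equation; as Y is
    zero modulo the maximal ideal, the diagonal blocks keep their reductions. *)
Lemma block_triangularize p q (A : 'M[R]_(p + q)) a c d :
    map_mx rho A = block_mx a 0 c d -> spectra_disjoint a d ->
  exists U alpha gamma delta,
  [/\ U \in unitmx, A *m U = U *m block_mx alpha 0 gamma delta,
      map_mx rho alpha = a & map_mx rho delta = d].
Proof.
rewrite -[A]submxK map_block_mx => /eq_block_mx[<- b0 _ <-] /sylvester_inverse[S SK SJ].
move: (ulsubmx A) (ursubmx A) (dlsubmx A) (drsubmx A) b0 S SK SJ.
move=> {}a b {}c {}d b0 S SK SJ.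
have [J X idJ JX||Y IY YE] :=
  riccati ker_ideal cI (L := sylvester a d) (b := b) c SJ _ SK.
- by apply: (mx_inB idJ); [apply: mx_in_mull | apply: mx_in_mulr].
- by move=> i j; have /matrixP/(_ i j) := b0; rewrite !mxE.
have rY : map_mx rho Y = 0 by apply/matrixP=> i j; rewrite !mxE; apply: IY.
exists (block_mx 1%:M Y 0 1%:M), (a - Y *m c), c, (c *m Y + d); split.
- by rewrite unitmxE det_ublock !det1 mulr1 unitr1.
- rewrite !mulmx_block !mulmx0 !mul0mx !mulmx1 !mul1mx !addr0 !add0r subrK.
  congr block_mx; have /eqP : a *m Y - Y *m d = Y *m c *m Y - b := YE.
  rewrite subr_eq => /eqP aY; rewrite aY mulmxDr mulmxA.
  by rewrite addrAC subrK.
- by rewrite map_mxB map_mxM rY mul0mx subr0.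
- by rewrite map_mxD map_mxM rY mulmx0 add0r.
Qed.

End CompleteLocal.

(** * Gauge transformations over power series *)

(** Course-of-values recursion, for unknown coefficients determined one after the
    other: [Phi n] may look at the values of index less than [n] only. *)
Lemma strong_recursion (T : Type) (t0 : T) (Phi : nat -> (nat -> T) -> T) :
    (forall n u v, (forall i, (i < n)%N -> u i = v i) -> Phi n u = Phi n v) ->
  exists u, forall n, u n = Phi n u.
Proof.
move=> Pext.
pose pre := fix pre n :=
  if n is m.+1 then rcons (pre m) (Phi m (nth t0 (pre m))) else [::].
have size_pre n : size (pre n) = n by elim: n => //= n IH; rewrite size_rcons IH.
exists (fun n => nth t0 (pre n.+1) n) => n.
have pre_nth m i : (i < m)%N -> nth t0 (pre m) i = nth t0 (pre i.+1) i.
  elim: m => // m IH; rewrite ltnS leq_eqVlt => /predU1P[-> //|im].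
  by rewrite [pre m.+1]/= nth_rcons size_pre im IH.
rewrite /= nth_rcons size_pre ltnn eqxx; apply: Pext => i im.
exact: pre_nth.
Qed.

Lemma map_mx_derivation (A : comNzRingType) (D : A -> A) m n p
    (P : 'M[A]_(m, n)) (Q : 'M[A]_(n, p)) :
    {morph D : f g / f + g} -> (forall f g, D (f * g) = D f * g + f * D g) ->
  map_mx D (P *m Q) = map_mx D P *m Q + P *m map_mx D Q.
Proof.
move=> DD DM; have D0 : D 0 = 0 by apply: (addrI (D 0)); rewrite -DD !addr0.
apply/matrixP=> i j; rewrite !mxE (big_morph D DD D0) -big_split /=.
by apply: eq_bigr => k _; rewrite DM !mxE.
Qed.

Section PowerSeries.
Variable R : comNzRingType.

Definition fps_eval0 (f : fps R) : R := fcoef f 0.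

Fact fps_eval0_zmod : zmod_morphism fps_eval0.
Proof. by []. Qed.

Fact fps_eval0_monoid : monoid_morphism fps_eval0.
Proof. by split=> // f g; rewrite /fps_eval0 /= big_ord1. Qed.

HB.instance Definition _ :=
  GRing.isZmodMorphism.Build (fps R) R fps_eval0 fps_eval0_zmod.
HB.instance Definition _ :=
  GRing.isMonoidMorphism.Build (fps R) R fps_eval0 fps_eval0_monoid.

Lemma fcoefC (a : R) n : fcoef (a%:A : fps R) n = if n is 0 then a else 0.
Proof. by case: n => [|n] /=; rewrite ?mulr1 ?mulr0. Qed.

Lemma fps_thetaC (a : R) : fps_theta (a%:A : fps R) = 0.
Proof. by apply: fpsP => -[|n]; rewrite /= ?mulr0n // mulr0 mul0rn. Qed.

(** The coefficients of the inverse are found one after the other. *)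
Lemma fps_unit_const1 (f : fps R) : fcoef f 0 = 1 -> exists g, f * g = 1.
Proof.
move=> f0.
have [|g gE] := @strong_recursion R 0
  (fun n g => (n == 0%N)%:R - \sum_(i < n) fcoef f i.+1 * g (n - i.+1)%N).
  move=> n u v uv; congr (_ - _); apply: eq_bigr => i _; rewrite uv //.
  by rewrite ltn_subrL; case: n i {uv} => [[]|].
exists (Fps g); apply: fpsP => n /=.
by rewrite big_ord_recl /= f0 mul1r subn0 {1}gE subrK.
Qed.

Definition mxcoef k m n (A : 'M[fps R]_(m, n)) : 'M[R]_(m, n) :=
  map_mx (fun f => fcoef f k) A.

Definition mxfps m n (u : nat -> 'M[R]_(m, n)) : 'M[fps R]_(m, n) :=
  \matrix_(i, j) Fps (fun k => u k i j).

Lemma mxfpsK k m n (u : nat -> 'M[R]_(m, n)) : mxcoef k (mxfps u) = u k.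
Proof. by apply/matrixP=> i j; rewrite !mxE. Qed.

Lemma mxcoefP m n (A B : 'M[fps R]_(m, n)) :
  (forall k, mxcoef k A = mxcoef k B) -> A = B.
Proof.
move=> AB; apply/matrixP=> i j; apply: fpsP => k.
by have /matrixP/(_ i j) := AB k; rewrite !mxE.
Qed.

Lemma fcoef_sum (I : Type) (s : seq I) (F : I -> fps R) k :
  fcoef (\sum_(i <- s) F i) k = \sum_(i <- s) fcoef (F i) k.
Proof. exact: (big_morph (fun f => fcoef f k)). Qed.

Lemma mxcoefM k m n p (A : 'M[fps R]_(m, n)) (B : 'M[fps R]_(n, p)) :
  mxcoef k (A *m B) = \sum_(i < k.+1) mxcoef i A *m mxcoef (k - i) B.
Proof.
apply/matrixP=> i j; rewrite !mxE fcoef_sum /= exchange_big summxE /=.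
by apply: eq_bigr => l _; rewrite mxE; apply: eq_bigr => h _; rewrite !mxE.
Qed.

Lemma mxcoefD k m n (A B : 'M[fps R]_(m, n)) :
  mxcoef k (A + B) = mxcoef k A + mxcoef k B.
Proof. by apply/matrixP=> i j; rewrite !mxE. Qed.

Lemma mxcoef_theta k m n (A : 'M[fps R]_(m, n)) :
  mxcoef k (map_mx (@fps_theta R) A) = mxcoef k A *+ k.
Proof. by apply/matrixP=> i j; rewrite mulmxnE !mxE. Qed.

Lemma mxcoef_const k m n (A : 'M[R]_(m, n)) :
  mxcoef k (map_mx (GRing.in_alg (fps R)) A) = if k is 0 then A else 0.
Proof.
by apply/matrixP=> i j; rewrite !mxE fcoefC; case: k => [|k]; rewrite ?mxE.
Qed.

Lemma mxcoefMC k m n p (A : 'M[fps R]_(m, n)) (B : 'M[R]_(n, p)) :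
  mxcoef k (A *m map_mx (GRing.in_alg (fps R)) B) = mxcoef k A *m B.
Proof.
rewrite mxcoefM (bigD1 ord_max) //= subnn (mxcoef_const 0) big1 ?addr0 // => i ik.
rewrite (mxcoef_const (k - i)).
case E: (k - i)%N => [|l]; last by rewrite mulmx0.
by case/eqP: ik; apply/val_inj/eqP; rewrite eqn_leq -ltnS ltn_ord /= -subn_eq0 E.
Qed.

(** The gauge matrix has entries in R[[x]], although it need only be invertible
    over R((x)): this lets the equation be stated and composed without leaving
    R[[x]], and suffices since the shears below only use positive powers of x. *)
Definition fps_gauge n (A A' : 'M[fps R]_n) : Prop :=
  exists2 P : 'M[fps R]_n, map_mx (@lau_of_fps R) P \in unitmx &
    A *m P + map_mx (@fps_theta R) P = P *m A'.

Lemma fps_gauge_trans n (A1 A2 A3 : 'M[fps R]_n) :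
  fps_gauge A1 A2 -> fps_gauge A2 A3 -> fps_gauge A1 A3.
Proof.
move=> [P uP PE] [Q uQ QE].
exists (P *m Q); first by rewrite map_mxM unitmx_mul uP.
rewrite map_mx_derivation; [|exact: fps_thetaD|exact: fps_thetaM].
by rewrite addrA mulmxA -mulmxDl PE -!mulmxA -mulmxDr QE.
Qed.

Lemma fps_gauge_const n (A : 'M[fps R]_n) (U V : 'M[R]_n) :
  V *m U = 1%:M ->
  fps_gauge A (map_mx (GRing.in_alg (fps R)) V *m A
     *m map_mx (GRing.in_alg (fps R)) U).
Proof.
move=> VU; exists (map_mx (GRing.in_alg (fps R)) U).
  suff /mulmx1_unit[_ ->] : map_mx (@lau_of_fps R) (map_mx (GRing.in_alg (fps R)) V) *m
     map_mx (@lau_of_fps R) (map_mx (GRing.in_alg (fps R)) U) = 1%:M by [].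
  by rewrite -!map_mxM VU !map_mx1.
rewrite !mulmxA -map_mxM (mulmx1C VU) map_mx1 mul1mx.
have -> : map_mx (@fps_theta R) (map_mx (GRing.in_alg (fps R)) U) = 0.
  by apply/matrixP=> i j; rewrite !mxE fps_thetaC.
by rewrite addr0.
Qed.

Lemma lau_fps_unit (f g : fps R) : f * g = 1 -> lau_of_fps f \is a GRing.unit.
Proof.
move=> fg; apply: (@lau_unitP _ _ (lau_of_fps g)).
by rewrite mulrC -rmorphM fg rmorph1.
Qed.

Lemma lau_fpsX_unit : lau_of_fps (fpsX : fps R) \is a GRing.unit.
Proof.
apply: (@lau_unitP _ _ (mklau 1 1)); rewrite mklauM -[RHS]/(mklau 1 0).
by apply: mklau_eq; rewrite expr0 addn0 expr1 !mul1r mulr1.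
Qed.

Definition fps_shift (f : fps R) : fps R := Fps (fun n => fcoef f n.+1).

Lemma fps_shiftK f : fcoef f 0 = 0 -> fpsX * fps_shift f = f.
Proof. by move=> f0; apply: fpsP => -[|n]; rewrite fcoefXM. Qed.

(** Conjugation by diag(x, 1) divides the upper right block by x and multiplies
    the lower left one by x, and the term theta P contributes 1 to the upper left
    block. *)
Lemma fps_gauge_shear p q (A : 'M[fps R]_(p + q)) :
  ursubmx (mxcoef 0 A) = 0 ->
  fps_gauge A (block_mx (ulsubmx A + 1%:M) (map_mx fps_shift (ursubmx A))
                        (fpsX *: dlsubmx A) (drsubmx A)).
Proof.
move=> A0; exists (block_mx fpsX%:M 0 0 1%:M).
  rewrite map_block_mx map_scalar_mx !map_mx0 map_mx1 unitmxE det_ublock det1 mulr1.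
  by rewrite det_scalar unitrX // lau_fpsX_unit.
have -> : map_mx (@fps_theta R) (block_mx fpsX%:M 0 0 1%:M) =
    block_mx fpsX%:M 0 0 0 :> 'M_(p + q).
  rewrite map_block_mx; congr block_mx; apply/matrixP=> i j; rewrite !mxE.
  - case: (_ == _); rewrite ?mulr1n ?mulr0n ?fps_thetaX //.
    by apply: fpsP => k /=; rewrite mul0rn.
  - by apply: fpsP => k /=; rewrite mul0rn.
  - by apply: fpsP => k /=; rewrite mul0rn.
  - by case: (_ == _); apply: fpsP => -[|k] /=; rewrite ?mul0rn.
rewrite -[A in LHS]submxK !mulmx_block add_block_mx.
rewrite !mulmx0 !mul0mx !mulmx1 !mul1mx !addr0 !add0r; congr block_mx.
- by rewrite mulmxDr mulmx1 scalar_mxC.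
- apply/matrixP=> i j; rewrite mul_scalar_mx !mxE fps_shiftK //.
  by have /matrixP/(_ i j) := A0; rewrite !mxE.
- by rewrite mul_mx_scalar.
Qed.

(** Comparing coefficients of x^k in A P + theta P = P A(0) gives
    (A_0 + k) P_k - P_k A_0 = - (A_1 P_(k-1) + ... + A_k P_0), which has a
    solution for k > 0; starting from P_0 = 1 makes [P] invertible. *)
Lemma fps_gauge_nonresonant n (A : 'M[fps R]_n) :
    (forall k, exists S : 'M[R]_n -> 'M[R]_n,
        cancel S (sylvester (mxcoef 0 A + k.+1%:R%:M) (mxcoef 0 A))) ->
  fps_gauge A (map_mx (GRing.in_alg (fps R)) (mxcoef 0 A)).
Proof.
move=> /choice[S SK].
have [|u uE] := @strong_recursion 'M[R]_n 0 (fun k u => if k is l.+1 then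
  S l (- \sum_(i < k) mxcoef i.+1 A *m u (k - i.+1)%N) else 1%:M).
  case=> // k u v uv; congr (S k (- _)); apply: eq_bigr => i _; rewrite uv //.
  by rewrite subSS ltnS leq_subr.
exists (mxfps u).
  rewrite unitmxE det_map_mx; have [|g g1] := @fps_unit_const1 (\det (mxfps u)).
    rewrite -[LHS]/(fps_eval0 _) -det_map_mx.
    by rewrite [map_mx _ _](mxfpsK 0 u) uE det1.
  exact: lau_fps_unit g1.
apply: mxcoefP => k; rewrite mxcoefD mxcoef_theta mxcoefMC mxcoefM !mxfpsK.
rewrite big_ord_recl subn0 mxfpsK.
case: k => [|k]; first by rewrite big_ord0 !addr0 uE mulmx1 mul1mx.
set T := \sum_(i < _) _.
have TE : T = \sum_(i < k.+1) mxcoef i.+1 A *m u (k.+1 - i.+1)%N.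
  by apply: eq_bigr => i _; rewrite mxfpsK.
have := SK k (- T); rewrite {1}TE -[S k _](uE k.+1) sylvesterE => /eqP.
rewrite subr_eq => /eqP E; rewrite -[RHS](addNKr T) -E.
by rewrite mulmxDl mul_scalar_mx scaler_nat [RHS]addrA [T + _]addrC.
Qed.

End PowerSeries.

Lemma fps_gauge_refl (R : comNzRingType) n (A : 'M[fps R]_n) : fps_gauge A A.
Proof.
exists 1%:M; first by rewrite map_mx1 unitmx1.
rewrite mulmx1 mul1mx (_ : map_mx _ _ = 0) ?addr0 //.
by apply/matrixP=> i j; rewrite !mxE -[(_ *+ _)]/(_%:R) -[1]scale1r -scaler_nat
  scalerA mulr1 fps_thetaC.
Qed.

Lemma mxcoef0M (R : comNzRingType) m n p (A : 'M[fps R]_(m, n)) (B : 'M[fps R]_(n, p)) :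
  mxcoef 0 (A *m B) = mxcoef 0 A *m mxcoef 0 B.
Proof. exact: (map_mxM (@fps_eval0 R)). Qed.

Lemma eigenvalue_ublock (F : fieldType) p q (a : 'M[F]_p) b (d : 'M[F]_q) z :
  eigenvalue (block_mx a b 0 d) z -> eigenvalue a z || eigenvalue d z.
Proof.
case/eigenvalueP=> v; rewrite -[v]hsubmxK mul_row_block scale_row_mx mulmx0 addr0.
move=> /eq_row_mx[va vd] v0; case: (eqVneq (lsubmx v) 0) => l0.
  apply/orP; right; apply/eigenvalueP; exists (rsubmx v).
    by rewrite -vd l0 mul0mx add0r.
  by apply: contra v0 => /eqP ->; rewrite l0 row_mx0.
by apply/orP; left; apply/eigenvalueP; exists (lsubmx v).
Qed.

Lemma eigenvalueD_scalar (F : fieldType) n (a : 'M[F]_n) c z :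
  eigenvalue (a + c%:M) z = eigenvalue a (z - c).
Proof.
by rewrite /eigenvalue /eigenspace raddfB /= opprB addrA.
Qed.

(** * The normal form *)

Section LaurentDerivation.
Variable R : comNzRingType.
Implicit Types a b : laurent R.

Lemma lau_thetaM a b : lau_theta (a * b) = lau_theta a * b + a * lau_theta b.
Proof.
elim/lau_ind: a => f i; elim/lau_ind: b => g j.
rewrite mklauM !lau_thetaE !mklauM mklauD -mulrDr; apply/esym/mklau_eq.
rewrite mulrA -exprD; congr (_ * _).
rewrite fps_thetaM mulrBl mulrBr addrACA mulrnDr opprD.
by rewrite mulrnAl mulrnAr.
Qed.

Lemma mklauDl f g i : mklau (f + g) i = mklau f i + mklau g i :> laurent R.
Proof. by rewrite mklauD -mulrDr; apply: mklau_eq; rewrite mulrA -exprD. Qed.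

Lemma mklauN f i : mklau (- f) i = - mklau f i :> laurent R.
Proof. by rewrite [RHS]mklocN. Qed.

Lemma mklau0 i : mklau 0 i = 0 :> laurent R.
Proof. by apply: mklau_eq; rewrite !mulr0. Qed.

Lemma lau_thetaD : {morph @lau_theta R : a b / a + b}.
Proof.
elim/lau_ind=> f i; elim/lau_ind=> g j.
have aux k l h :
    fps_theta (fpsX ^+ k * h) - (fpsX ^+ k * h) *+ (l + k) =
    fpsX ^+ k * (fps_theta h - h *+ l) :> fps R.
  rewrite fps_thetaM fps_thetaXn mulrnAl mulrBr mulrnAr mulrnDr opprD.
  rewrite [X in X + _]addrC -addrA; congr (_ + _).
  by rewrite addrCA subrr addr0.
rewrite mklauD !lau_thetaE mklauD -!aux fps_thetaD mulrnDl opprD addrACA.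
by rewrite [(j + i)%N]addnC.
Qed.

End LaurentDerivation.

Section TauNormalForm.
Variables (C : closedFieldType) (R : comUnitAlgType C) (rho : {rmorphism R -> C}).
Hypothesis rhoC : forall c, rho c%:A = c.
Hypothesis cI : is_adic_complete [set a | rho a = 0]%classic.

Definition residue_spectrum n (A : 'M[fps R]_n) : pred C :=
  eigenvalue (map_mx rho (mxcoef 0 A)).

(** The eigenvalues in [Q] are raised by 1, the others stay. A constant gauge
    makes the reduction of A(0) block diagonal, a second one makes A(0) block
    lower triangular over [R], and then the shear applies. After the shear it is
    the lower left block that vanishes at x = 0, so the spectrum is still read on
    the diagonal blocks. *)
Lemma fps_gauge_raise n (A : 'M[fps R]_n) (Q : pred C) :
  exists2 A', fps_gauge A A' &
    forall z, residue_spectrum A' z ->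
      residue_spectrum A (z - 1) && Q (z - 1) || residue_spectrum A z && ~~ Q z.
Proof.
have [p [q [e [g [a [d [ug gA aQ dQ]]]]]]] :=
  spectral_split (map_mx rho (mxcoef 0 A)) Q.
subst n; rewrite castmx_id in gA.
pose G := map_mx (GRing.in_alg R) g; pose G' := map_mx (GRing.in_alg R) (invmx g).
have GG' : G *m G' = 1%:M by rewrite -map_mxM mulmxV // map_mx1.
have rhoG h : map_mx rho (map_mx (GRing.in_alg R) h) = h :> 'M_(p + q).
  by apply/matrixP=> i j; rewrite !mxE rhoC.
have g1 := fps_gauge_const A GG'; set A1 := (X in fps_gauge A X) in g1.
have A10 : map_mx rho (mxcoef 0 A1) = block_mx a 0 0 d.
  rewrite !mxcoef0M !(mxcoef_const 0) !map_mxM !rhoG.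
  by rewrite gA -mulmxA mulmxV // mulmx1.
clearbody A1; have ad : spectra_disjoint a d.
  by move=> z /aQ/andP[_ Qz]; apply/negP => /dQ/andP[_]; rewrite Qz.
have [U [alpha [gamma [delta [uU AU ra rd]]]]] := block_triangularize rhoC cI A10 ad.
have g2 := fps_gauge_const A1 (mulVmx uU); set A2 := (X in fps_gauge A1 X) in g2.
have A20 : mxcoef 0 A2 = block_mx alpha 0 gamma delta.
  rewrite !mxcoef0M !(mxcoef_const 0) -mulmxA AU mulmxA.
  by rewrite mulVmx // mul1mx.
clearbody A2; have g3 := @fps_gauge_shear R p q A2; rewrite A20 block_mxKur in g3.
have {}g3 := g3 erefl; set A3 := (X in fps_gauge A2 X) in g3.
exists A3; first exact: fps_gauge_trans (fps_gauge_trans g1 g2) g3.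
have A30 : map_mx rho (mxcoef 0 A3) =
    block_mx (a + 1%:M) (map_mx rho (mxcoef 0 (ursubmx A3))) 0 d.
  rewrite /mxcoef !map_block_mx; congr block_mx.
  - rewrite (map_mxD (@fps_eval0 R)) map_mx1 map_mxD map_mx1 -ra.
    congr (map_mx _ _ + _).
    have /(congr1 ulsubmx) := A20; rewrite block_mxKul => <-.
    by apply/matrixP=> i j; rewrite !mxE.
  - by rewrite block_mxKur.
  - by apply/matrixP=> i j; rewrite !mxE fcoefXM rmorph0.
  - rewrite -rd; congr (map_mx _ _).
    have /(congr1 drsubmx) := A20; rewrite block_mxKdr => <-.
    by apply/matrixP=> i j; rewrite !mxE.
move=> z; rewrite /residue_spectrum A30 => /eigenvalue_ublock.
by rewrite eigenvalueD_scalar => /orP[/aQ ->|/dQ ->]; rewrite ?orbT.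
Qed.

Variable tau : set C.

(** Induction on a bound for the number of steps that separate each eigenvalue
    from [tau]: raising all those outside [tau] lowers this bound by one. *)
Lemma fps_gauge_into_tau N n (A : 'M[fps R]_n) :
    (forall z, residue_spectrum A z -> exists2 k, (k <= N)%N & tau (z + k%:R)) ->
  exists2 A', fps_gauge A A' & forall z, residue_spectrum A' z -> tau z.
Proof.
elim: N A => [|N IH] A AN.
  exists A; first exact: fps_gauge_refl.
  by move=> z /AN[k]; rewrite leqn0 => /eqP ->; rewrite addr0.
have [A1 g1 A1P] := fps_gauge_raise A (fun z => ~~ `[< tau z >]).
have [|A2 g2 A2P] := IH A1; last first.
  by exists A2; [apply: fps_gauge_trans g1 g2 | apply: A2P].
move=> z /A1P/orP[/andP[/AN[k kN tk] /asboolPn ntau]|/andP[_]]; last first.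
  by rewrite negbK => /asboolP tz; exists 0%N; rewrite ?addr0.
case: k kN tk => [|k] kN tk; first by rewrite addr0 in tk.
by exists k => //; move: tk; rewrite -natr1 addrA addrAC subrK.
Qed.

Hypothesis charC : [pchar C] =i pred0.
Hypothesis tauZ : is_transversal_mod_int tau.

Lemma transversal_inj_nat z k : tau z -> tau (z - k.+1%:R) -> False.
Proof.
move=> tz tz'; have [t [_ tU]] := tauZ z.
have E : z = z - k.+1%:R.
  rewrite -(tU (z - k.+1%:R)); last first.
    by split=> //; exists k.+1; rewrite opprB addrC subrK.
  by apply/esym/tU; split=> //; exists 0; rewrite subrr.
have : k.+1%:R = 0 :> C by rewrite -[k.+1%:R](subKr z) -E subrr.
by move/eqP; have /pcharf0P -> := charC.
Qed.

(** All eigenvalues can be brought below [tau] by a scalar gauge x^-N, which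
    subtracts N, because there are finitely many of them. For N a bound on their
    distances to their representatives in [tau], the number of steps up to
    [tau] is then at most 2 N. *)
Lemma tau_normal_form n (A : 'M[fps R]_n) :
  exists (P : 'M[laurent R]_n) (B : 'M[R]_n),
  [/\ P \in unitmx,
      map_mx (@lau_of_fps R) A *m P + map_mx (@lau_theta R) P
        = P *m map_mx (@lau_const R) B &
      forall z, eigenvalue (map_mx rho B) z -> tau z].
Proof.
have [N AN] : exists N : nat, forall z, residue_spectrum A z ->
    exists2 k, (k <= N + N)%N & tau (z - N%:R + k%:R).
  have [s sA] := closed_field_poly_normal (char_poly (map_mx rho (mxcoef 0 A))).
  have [N sN] : exists N : nat, forall z, z \in s -> exists2 m : int,
      (`|m| <= N)%N & tau (z - m%:~R).
    elim: s {sA} => [|w s [N IH]]; first by exists 0%N.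
    have [t [[tt [m mt]] _]] := tauZ w; exists (maxn `|m| N) => z.
    rewrite inE => /predU1P[->|/IH[l lN tl]].
      by exists m; rewrite ?leq_maxl // -mt subKr.
    by exists l => //; rewrite leq_max lN orbT.
  (* If z - m is in tau, then z - N has to be raised N - m times. *)
  exists N => z; rewrite /residue_spectrum eigenvalue_root_char sA.
  rewrite (monicP (char_poly_monic _)) scale1r root_prod_XsubC => /sN[m mN tm].
  exists `|N%:Z - m|%N; first by lia.
  rewrite (_ : z - _ + _ = z - m%:~R) //.
  have : `|N%:Z - m|%:Z = N%:Z - m by lia.
  move=> /(congr1 (intmul (1 : C))); rewrite mulrzBr => E.
  by rewrite [_%:R in X in _ + X]E addrA subrK.
have [A1 g1 A1P] : exists2 A', fps_gauge (A - (N%:R)%:M) A' &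
    forall z, residue_spectrum A' z -> tau z.
  apply: (@fps_gauge_into_tau (N + N)) => z; rewrite /residue_spectrum.
  have -> : map_mx rho (mxcoef 0 (A - N%:R%:M)) =
      map_mx rho (mxcoef 0 A) + (- N%:R)%:M.
    rewrite [mxcoef 0 (_ - _)](map_mxB (@fps_eval0 R)) map_mxB; congr (_ + _).
    rewrite !map_scalar_mx /= (rmorph_nat (@fps_eval0 R)) (rmorph_nat rho).
    by rewrite raddfN.
  rewrite eigenvalueD_scalar opprK => /AN[k kN tk]; exists k => //.
  by rewrite addrK in tk.
(* Eigenvalues of the reduction of A1(0) lie in tau, where no two elements differ
   by a positive integer; hence A1(0) is not resonant. *)
have g2 : fps_gauge A1 (map_mx (GRing.in_alg (fps R)) (mxcoef 0 A1)).
  apply: fps_gauge_nonresonant => k.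
  have [|S SK _] := @sylvester_inverse _ _ _ rhoC cI _ _
    (mxcoef 0 A1 + k.+1%:R%:M) (mxcoef 0 A1); last by exists S.
  move=> z; rewrite map_mxD map_scalar_mx rmorph_nat eigenvalueD_scalar => /A1P tz.
  by apply/negP => /A1P tz'; apply: transversal_inj_nat tz' tz.
have [P uP PE] := fps_gauge_trans g1 g2.
pose s : laurent R := mklau 1 N; pose T := map_mx (@lau_of_fps R) P.
have us : s \is a GRing.unit.
  apply: (@lau_unitP _ _ (mklau (fpsX ^+ N) 0)); rewrite mklauM -[RHS]/(mklau 1 0).
  by apply: mklau_eq; rewrite add0n expr0 mul1r.
have ts : lau_theta s = - (N%:R * s).
  have t1 : fps_theta (1 : fps R) = 0.
    by rewrite -[1 : fps R](expr0 fpsX) fps_thetaXn mulr0n.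
  rewrite lau_thetaE t1 sub0r mklauN -(rmorph_nat (@lau_of_fps R)).
  by rewrite mklauM add0n mulr1.
have theta_lau m k (M : 'M[fps R]_(m, k)) :
    map_mx (@lau_theta R) (map_mx (@lau_of_fps R) M)
    = map_mx (@lau_of_fps R) (map_mx (@fps_theta R) M).
  by apply/matrixP=> i j; rewrite !mxE lau_thetaE mulr0n subr0.
exists (s *: T), (mxcoef 0 A1); split; last exact: A1P.
  by rewrite unitmxZ.
have -> : map_mx (@lau_theta R) (s *: T) =
    s *: (map_mx (@lau_theta R) T - N%:R *: T).
  apply/matrixP=> i j; rewrite !mxE lau_thetaM ts mulrBr addrC mulNr.
  by rewrite mulrCA mulrA.
rewrite -scalemxAr -scalemxAl -scalerDr; congr (_ *: _).
rewrite theta_lau addrCA -[N%:R *: T]mul_scalar_mx -mulmxBl.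
have -> : map_mx (@lau_of_fps R) A - N%:R%:M =
    map_mx (@lau_of_fps R) (A - N%:R%:M).
  by rewrite map_mxB /= map_scalar_mx /= (rmorph_nat (@lau_of_fps R)).
rewrite /T -map_mxM addrC -map_mxD PE map_mxM; congr (_ *m _).
by rewrite -map_mx_comp.
Qed.

End TauNormalForm.

(** * Bases, connection matrices and isomorphisms *)

Section DualBasis.
Variables (A : comNzRingType) (V : lmodType A) (n : nat).

(** A basis is carried together with its coordinate map: on localizations and
    tensor products, which are quotients, coordinates are easier to construct
    than linear independence is to prove. *)
Definition dual_basis (e : 'I_n -> V) (x : V -> 'cV[A]_n) : Prop :=
  [/\ forall a u v, x (a *: u + v) = a *: x u + x v,
      forall v, v = \sum_i x v i 0 *: e i &
      forall j, x (e j) = delta_mx j 0].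

Variables (e : 'I_n -> V) (x : V -> 'cV[A]_n).
Hypothesis ex : dual_basis e x.

Lemma dual_basisD u v : x (u + v) = x u + x v.
Proof. by have [xP _ _] := ex; have := xP 1 u v; rewrite !scale1r. Qed.

Lemma dual_basis0 : x 0 = 0.
Proof. by apply: (addrI (x 0)); rewrite -dual_basisD !addr0. Qed.

Lemma dual_basisZ a u : x (a *: u) = a *: x u.
Proof. by have [xP _ _] := ex; have := xP a u 0; rewrite dual_basis0 !addr0. Qed.

Lemma dual_basisN u : x (- u) = - x u.
Proof. by rewrite -scaleN1r dual_basisZ scaleN1r. Qed.

Lemma dual_basisK (c : 'cV[A]_n) : x (\sum_i c i 0 *: e i) = c.
Proof.
rewrite (big_morph x dual_basisD dual_basis0) [RHS]matrix_sum_delta.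
apply: eq_bigr => i _; rewrite big_ord1 dual_basisZ.
by have [_ _ ->] := ex.
Qed.

Lemma dual_basis_inj : injective x.
Proof. by move=> u v xuv; have [_ xv _] := ex; rewrite (xv u) (xv v) xuv. Qed.

End DualBasis.

(** The finitely many elements of a basis that occur in the expressions of the
    generators already span. *)
Lemma free_fg_dual_basis (A : comNzRingType) (V : lmodType A) :
  fin_gen V -> is_free V ->
  exists (n : nat) (e : 'I_n -> V) (x : V -> 'cV[A]_n), dual_basis e x.
Proof.
move=> [m [g gP]] [S [Sgen Sfree]].
have /choice[s sP] i : exists s : seq V, exists c : V -> A,
     [/\ uniq s, (forall e, e \in s -> S e) & g i = \sum_(e <- s) c e *: e].
  by have [t [c tc]] := Sgen (g i); exists t, c.
have /choice[c cP] := sP.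
pose t := undup (flatten (codom s)).
have st i : {subset s i <= t}.
  move=> v vs; rewrite mem_undup; apply/flattenP; exists (s i) => //.
  exact: codom_f.
have tS v : v \in t -> S v.
  by rewrite mem_undup => /flattenP[_ /codomP[i ->]]; have [_ + _] := cP i; apply.
have gt i : g i = \sum_(v <- t) (if v \in s i then c i v else 0) *: v.
  have [us _ ->] := cP i; rewrite [RHS](bigID (mem (s i))) /= [X in _ + X]big1 ?addr0.
    rewrite [RHS](eq_bigr (fun v => c i v *: v)) => [|v ->] //.
    rewrite -[RHS]big_filter; apply: perm_big; apply: uniq_perm => //.
      by rewrite filter_uniq ?undup_uniq.
    by move=> v; rewrite mem_filter /=; case vs: (v \in s i) => //=; rewrite (st i).
  by move=> v /negPf ->; rewrite scale0r.
pose e (i : 'I_(size t)) := nth 0 t i.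
have sume (d : V -> A) : \sum_(v <- t) d v *: v = \sum_i d (e i) *: e i.
  by rewrite (big_nth 0) big_mkord.
have /choice[x xP] v : exists d : 'cV[A]_(size t), v = \sum_i d i 0 *: e i.
  have [a ->] := gP v.
  exists (\col_j \sum_i a i * (if e j \in s i then c i (e j) else 0)).
  under [RHS]eq_bigr => j _ do rewrite mxE scaler_suml.
  rewrite exchange_big; apply: eq_bigr => i _ /=; rewrite gt sume scaler_sumr.
  by apply: eq_bigr => j _; rewrite scalerA.
have xU (d : 'cV[A]_(size t)) : \sum_i d i 0 *: e i = 0 -> d = 0.
  move=> d0; pose f v := if insub (index v t) is Some i then d i 0 else 0.
  have fe i : f (e i) = d i 0.
    by rewrite /f index_uniq ?undup_uniq // valK.
  apply/matrixP=> i j; rewrite ord1 mxE -fe.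
  apply: (Sfree t f (undup_uniq _) tS); last exact: mem_nth.
  by rewrite sume -[RHS]d0; apply: eq_bigr => k _; rewrite fe.
have xI (d d' : 'cV[A]_(size t)) :
    \sum_i d i 0 *: e i = \sum_i d' i 0 *: e i -> d = d'.
  move=> dd; apply/eqP; rewrite -subr_eq0; apply/eqP/xU.
  rewrite -[RHS](subrr (\sum_i d' i 0 *: e i)) -{1}dd -sumrB.
  by apply: eq_bigr => i _; rewrite !mxE scalerBl.
exists (size t), e, x; split=> [a u v|//|j]; apply: xI.
  rewrite -xP [in LHS](xP u) [in LHS](xP v) scaler_sumr -big_split /=.
  by apply: eq_bigr => i _; rewrite !mxE scalerDl scalerA.
rewrite -xP (bigD1 j) //= big1 ?addr0 ?mxE ?eqxx ?scale1r // => i ij.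
by rewrite mxE (negPf ij) scale0r.
Qed.

Section GaugeIsomorphism.
Variables (R A : comNzRingType) (iota : R -> A) (theta : A -> A).
Variables (M N : connection iota theta) (n : nat).

Definition connection_matrix (M : connection iota theta) (x : M -> 'cV[A]_n)
    (H : 'M[A]_n) : Prop :=
  forall u, x (nabla u) = map_mx theta (x u) + H *m x u.

Lemma dual_basis_map (V V' : lmodType A) e e'
    (x : V -> 'cV[A]_n) (x' : V' -> 'cV[A]_n) (Q : 'M[A]_n) :
  dual_basis e x -> dual_basis e' x' ->
  exists phi : {linear V -> V'}, forall u, x' (phi u) = Q *m x u.
Proof.
move=> ex ex'; pose f u := \sum_i (Q *m x u) i 0 *: e' i.
have fE u : x' (f u) = Q *m x u by apply: dual_basisK.
have f_lin : linear f.
  move=> a u v; apply: (dual_basis_inj ex').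
  rewrite (dual_basisD ex') (dual_basisZ ex') !fE.
  by rewrite (dual_basisD ex) (dual_basisZ ex) mulmxDr scalemxAr.
by exists (HB.pack_for {linear V -> V'} f (GRing.isLinear.Build _ _ _ _ f f_lin)).
Qed.

(** In coordinates the isomorphism from [N] to [M] is multiplication by [P]. It
    is horizontal because theta (P v) + H P v = P (theta v + K v). *)
Lemma gauge_conn_iso e x f y (H K P : 'M[A]_n) :
    {morph theta : a b / a + b} ->
    (forall a b, theta (a * b) = theta a * b + a * theta b) ->
    @dual_basis A M n e x -> @dual_basis A N n f y ->
    connection_matrix x H -> connection_matrix y K ->
    (exists2 Q, Q *m P = 1%:M & H *m P + map_mx theta P = P *m K) ->
  conn_iso M N.
Proof.
move=> thD thM ex fy xH yK [Q QP HP].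
have PQ := mulmx1C QP.
have [phi phiE] := dual_basis_map Q ex fy.
have [psi psiE] := dual_basis_map P fy ex.
have psi_hom : conn_hom psi.
  move=> v; apply: (dual_basis_inj ex); rewrite psiE yK xH psiE.
  rewrite map_mx_derivation // mulmxA addrAC -mulmxDl addrC [_ *m P + _]addrC in HP *.
  by rewrite mulmxDr mulmxA -HP addrC.
have phiK : cancel phi psi.
  by move=> u; apply: (dual_basis_inj ex); rewrite psiE phiE mulmxA PQ mul1mx.
have psiK : cancel psi phi.
  by move=> u; apply: (dual_basis_inj fy); rewrite phiE psiE mulmxA QP mul1mx.
exists phi, psi; split=> // u.
by rewrite -[u in LHS]phiK -psi_hom psiK.
Qed.

End GaugeIsomorphism.

(** * The bases of the localization and of the Euler module *)

Section LocalizationBasis.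
Variables (R : comNzRingType) (M : MC_log R) (n : nat).
Variables (e : 'I_n -> M) (x : M -> 'cV[fps R]_n).
Hypothesis ex : dual_basis e x.

Lemma connection_matrix_exists : exists H, connection_matrix x H.
Proof.
have [_ xu _] := ex; exists (\matrix_(i, j) x (nabla (e j)) i 0) => u.
have nD : {morph @nabla _ _ _ _ M : v w / v + w}.
  by move=> v w; have := nabla_linear 1 v w; rewrite rmorph1 !scale1r.
have n0 : nabla (0 : M) = 0 by apply: (addrI (nabla 0)); rewrite -nD !addr0.
rewrite {1}(xu u) (big_morph _ nD n0).
under eq_bigr => j _ do rewrite nabla_leibniz.
rewrite big_split (dual_basisD ex); congr (_ + _).
  by rewrite -[RHS](dual_basisK ex); congr x; apply: eq_bigr => j _; rewrite mxE.
rewrite (big_morph x (dual_basisD ex) (dual_basis0 ex)).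
apply/matrixP=> i j; rewrite ord1 summxE mxE; apply: eq_bigr => k _.
by rewrite (dual_basisZ ex) !mxE mulrC.
Qed.

Definition loc_coord (u : locmod M) : 'cV[laurent R]_n :=
  map_mx (fun f => mklau f (repr u).2) (x (repr u).1).

Lemma loc_coordE m k : loc_coord (mkloc m k) = map_mx (fun f => mklau f k) (x m).
Proof.
have : mkloc (repr (mkloc m k)).1 (repr (mkloc m k)).2 = mkloc m k.
  by rewrite /mkloc -surjective_pairing reprK.
rewrite /loc_coord; case: (repr _) => m' k' /= /mklocP[j /(congr1 x)].
rewrite !(dual_basisZ ex) => /matrixP E; apply/matrixP=> i l; rewrite !mxE.
by apply/mklauP; exists j; have := E i l; rewrite !mxE.
Qed.

Lemma loc_dual_basis : dual_basis (fun i => mkloc (e i) 0) loc_coord.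
Proof.
have [_ xv xe] := ex; split=> [a u v|v|j].
- elim/lau_ind: a => f i; elim/locmod_ind: u => m j; elim/locmod_ind: v => m' k.
  rewrite mklau_scale mklocD !loc_coordE (dual_basisD ex) !(dual_basisZ ex).
  by apply/matrixP=> l h; rewrite !mxE mklauM mklauD.
- elim/locmod_ind: v => m k; rewrite loc_coordE.
  have mkD : {morph (fun m : M => mkloc m k) : m m' / m + m'}.
    move=> m1 m2; rewrite mklocD -scalerDr; apply: mkloc_eq.
    by rewrite scalerA -exprD.
  have mk0 : mkloc (0 : M) k = 0 by apply: mkloc_eq; rewrite !scaler0.
  rewrite {1}(xv m) (big_morph _ mkD mk0); apply: eq_bigr => i _.
  by rewrite mxE mklau_scale addn0.
- rewrite loc_coordE xe; apply/matrixP=> i l; rewrite !mxE.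
  by rewrite -[LHS]/(lau_of_fps _) rmorph_nat.
Qed.

Lemma loc_connection_matrix (H : 'M[fps R]_n) : connection_matrix x H ->
  @connection_matrix _ _ _ _ n (gamma M) loc_coord (map_mx (@lau_of_fps R) H).
Proof.
move=> xH; elim/locmod_ind=> m k; rewrite /= gamma_nablaE !loc_coordE.
rewrite (dual_basisD ex) (dual_basisN ex) xH.
have xMn j : x (m *+ j) = x m *+ j.
  by elim: j => [|j IH]; rewrite ?(dual_basis0 ex) // !mulrS (dual_basisD ex) IH.
rewrite xMn; apply/matrixP=> i l; rewrite !mxE mulmxnE addrAC mklauDl lau_thetaE.
congr (_ + _); rewrite (big_morph _ (fun f g => mklauDl f g k) (mklau0 R k)).
by apply: eq_bigr => j _; rewrite !mxE mklauM add0n.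
Qed.

End LocalizationBasis.

Section EulerBasis.
Variables (R : comNzRingType) (n : nat) (b : 'M[R]_n).
Local Notation W := 'cV[R]_n.

Lemma cV_sum_delta (w : W) : w = \sum_i w i 0 *: delta_mx i 0.
Proof. by rewrite [LHS]matrix_sum_delta; apply: eq_bigr => i _; rewrite big_ord1. Qed.

Lemma cV_fin_gen : fin_gen W.
Proof.
exists n, (fun i => delta_mx i 0) => w; exists (fun i => w i 0).
exact: cV_sum_delta.
Qed.

Lemma cV_free_finite_rank : is_free_finite_rank W.
Proof.
exists [set w | exists i : 'I_n, w = delta_mx i 0]%classic.
  apply: (@sub_finite_set _ _ [set` [seq (delta_mx i 0 : W) | i : 'I_n]]).
    by move=> _ [i ->]; apply/mapP; exists i; rewrite ?mem_enum.
  exact: finite_seq.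
split=> [w|s c us sS sc w ws].
  exists [seq delta_mx i 0 | i : 'I_n].
  exists (fun v => \sum_i (if v == delta_mx i 0 then w i 0 else 0)).
  have dinj : injective (fun i => delta_mx i 0 : W).
    move=> i j /matrixP/(_ i 0); rewrite !mxE !eqxx andbT; case: eqVneq => //= _.
    by move/eqP; rewrite oner_eq0.
  split; first by rewrite map_inj_uniq ?enum_uniq.
    by move=> _ /mapP[i _ ->]; exists i.
  rewrite big_map big_enum {1}[w]cV_sum_delta; apply: eq_bigr => i _.
  congr (_ *: _); rewrite (bigD1 i) //= eqxx big1 ?addr0 // => j ji.
  by rewrite (inj_eq dinj) eq_sym (negPf ji).
have [i wE] := sS w ws.
have /matrixP/(_ i 0) := sc; rewrite summxE (bigD1_seq w) //= big_seq_cond big1 ?addr0.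
  by rewrite wE !mxE !eqxx mulr1.
move=> v /andP[/sS[j ->]]; rewrite wE !mxE andbT.
by case: (eqVneq i j) => [->|]; rewrite ?eqxx // mulr0.
Qed.

Definition tens_coord_seq (s : seq (fps R * W)) : 'cV[fps R]_n :=
  \sum_(p <- s) p.1 *: map_mx (GRing.in_alg (fps R)) p.2.

Definition tens_coord (u : tens (fps R) W) := tens_coord_seq (repr u).

Lemma tens_coordE s : tens_coord (mktens s) = tens_coord_seq s.
Proof.
rewrite /tens_coord /tens_coord_seq; move: (repr_mktens s); move: (repr _) => t.
elim=> {s t}.
- by move=> s.
- by move=> s t _ ->.
- by move=> s t u _ -> _ ->.
- by move=> s s' t t' _ E _ E'; rewrite !big_cat /= E E'.
- by move=> s t; rewrite !big_cat /= addrC.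
- by move=> w; rewrite big_seq1 big_nil scale0r.
- by move=> f g w; rewrite !big_cons !big_nil !addr0 scalerDl.
- by move=> f v w; rewrite !big_cons !big_nil !addr0 map_mxD scalerDr.
- move=> c f w; rewrite !big_seq1 /=; apply/matrixP=> i j; rewrite !mxE /=.
  by rewrite !mulr_algr scalerA mulrC.
Qed.

Lemma tens_coord_tmul f w :
  tens_coord (tmul f w) = f *: map_mx (GRing.in_alg (fps R)) w.
Proof. by rewrite tens_coordE /tens_coord_seq big_seq1. Qed.

Lemma tens_dual_basis :
  dual_basis (fun i => tmul 1 (delta_mx i 0) : tens (fps R) W) tens_coord.
Proof.
split=> [f u v|u|j].
- elim/tens_ind: u => s; elim/tens_ind: v => t.
  rewrite [_ *: _]tens_scaleE mktensD !tens_coordE /tens_coord_seq big_cat big_map.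
  by rewrite scaler_sumr; congr (_ + _); apply: eq_bigr => p _; rewrite scalerA.
- elim/tens_ind: u => s; rewrite tens_coordE mktens_sum.
  under [RHS]eq_bigr => i _ do rewrite summxE scaler_suml.
  rewrite exchange_big; apply: eq_bigr => -[f w] _ /=.
  rewrite {1}[w]cV_sum_delta tmul_sumr; apply: eq_bigr => i _.
  by rewrite -tmul_bal !mxE tmulZ mulr1 /= -scalerAr mulr1.
- rewrite tens_coord_tmul scale1r; apply/matrixP=> i k; rewrite !mxE.
  by rewrite rmorph_nat.
Qed.

Definition mul_cV : {linear W -> W} := mulmx b.

Lemma euler_connection_matrix :
  @connection_matrix _ _ _ _ n (eul mul_cV cV_fin_gen) tens_coord
    (map_mx (GRing.in_alg (fps R)) b).
Proof.
elim/tens_ind=> s; rewrite /= euler_map_mktens mktens_euler mktens_sum.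
have yD := dual_basisD tens_dual_basis; have y0 := dual_basis0 tens_dual_basis.
have tD : {morph map_mx (@fps_theta R) : u v / u + v :> 'cV_n}.
  by move=> u v; apply/matrixP=> i j; rewrite !mxE fps_thetaD.
have t0 : map_mx (@fps_theta R) 0 = 0 :> 'cV_n.
  by apply: (addrI (map_mx (@fps_theta R) 0)); rewrite -tD !addr0.
rewrite !(big_morph tens_coord yD y0) (big_morph _ tD t0) mulmx_sumr -big_split.
apply: eq_bigr => -[f w] _; rewrite yD !tens_coord_tmul -scalemxAr -map_mxM.
congr (_ + _); apply/matrixP=> i j.
by rewrite !mxE fps_thetaM fps_thetaC mulr0 addr0.
Qed.

End EulerBasis.

(** * Reduction modulo the maximal ideal *)

Lemma eigenvalue_col (F : fieldType) n (b : 'M[F]_n) (v : 'cV[F]_n) z :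
  v != 0 -> b *m v = z *: v -> eigenvalue b z.
Proof.
move=> v0 bv; rewrite /eigenvalue /eigenspace kermx_eq0 row_free_unit.
apply: contra v0 => u; rewrite -(mulKmx u v) mulmxBl bv mul_scalar_mx subrr.
by rewrite mulmx0.
Qed.

Section Residue.
Variables (C : fieldType) (R : comUnitAlgType C) (r : set R).
Hypotheses (idr : is_ideal r) (resr : has_residue_field r).

Lemma residueP a : r (a - (residue r a)%:A).
Proof.
rewrite /residue; case: xgetP => [c _ //|].
by have [c [rc _]] := resr a; move=> /(_ c)/(_ rc).
Qed.

Lemma residue_unique a c : r (a - c%:A) -> residue r a = c.
Proof.
by move=> rc; have [d [_ dU]] := resr a; rewrite -(dU _ rc); apply/esym/dU/residueP.
Qed.

Lemma residue_rmorphism : exists rho : {rmorphism R -> C},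
  [/\ rho =1 residue r, forall c, rho c%:A = c & [set a | rho a = 0]%classic = r].
Proof.
have [r0 rD rZ] := idr.
have rN a : r a -> r (- a) by move=> ra; rewrite -mulN1r; apply: rZ.
have zm : zmod_morphism (residue r).
  move=> a b; apply: residue_unique; rewrite scalerBl opprD addrACA -opprD.
  by apply: rD; [|apply: rN]; apply: residueP.
have mm : monoid_morphism (residue r).
  split=> [|a b]; apply: residue_unique; first by rewrite scale1r subrr.
  have -> : a * b - (residue r a * residue r b)%:A =
      b * (a - (residue r a)%:A) + (residue r a)%:A * (b - (residue r b)%:A).
    rewrite -[(_ * _)%:A]/(GRing.in_alg R _) rmorphM /= !mulrBr.
    by rewrite [b * a]mulrC [b * _]mulrC addrA subrK.
  by apply: rD; apply: rZ; apply: residueP.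
pose rho : {rmorphism R -> C} := HB.pack_for {rmorphism R -> C} (residue r)
  (GRing.isZmodMorphism.Build R C (residue r) zm)
  (GRing.isMonoidMorphism.Build R C (residue r) mm).
exists rho; split=> // [c|].
  by apply: residue_unique; rewrite subrr.
apply/seteqP; split=> a /= ra; last by apply: residue_unique; rewrite scale0r subr0.
by have ra0 : residue r a = 0 := ra; have := residueP a; rewrite ra0 scale0r subr0.
Qed.

End Residue.

(** A column over R is zero modulo the maximal ideal exactly when its entries
    vanish under [rho]; an eigenvector of the reduction is therefore a column
    eigenvector of the reduced matrix. *)
Lemma reduction_eigenvalue_mx (C : fieldType) (R : comUnitAlgType C)
    (rho : {rmorphism R -> C}) n (b : 'M[R]_n) z :
    (forall c, rho c%:A = c) ->
  reduction_eigenvalue [set a | rho a = 0]%classic (mul_cV b) z ->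
  eigenvalue (map_mx rho b) z.
Proof.
move=> rhoC [u]; elim/mq_ind: u => w w0.
rewrite mq_mapE -[_ *: _]/(mq_scale _ _) mq_piZ => /mq_piP.
move=> [m [a [y [a0 E]]]].
apply: (@eigenvalue_col _ _ _ (map_mx rho w)).
  apply: contra_notN w0 => /eqP/matrixP w0.
  have pi0 : mq_pi [set a | rho a = 0]%classic (0 : 'cV[R]_n) = 0.
    by apply: (addrI (mq_pi _ 0)); rewrite -mq_piD !addr0.
  rewrite -pi0; apply/mq_piP; rewrite subr0.
  exists n, (fun i => w i 0), (fun i => delta_mx i 0); split; last exact: cV_sum_delta.
  by move=> i /=; have := w0 i 0; rewrite !mxE.
have ker0 : map_mx rho (mul_cV b w - z%:A *: w) = 0.
  rewrite E; apply/matrixP=> i j; rewrite !mxE summxE rmorph_sum big1 // => k _.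
  by rewrite mxE rmorphM (a0 k) mul0r.
apply/eqP; rewrite -subr_eq0 -map_mxM -[z]rhoC -map_mxZ -map_mxB.
exact/eqP/ker0.
Qed.

Lemma transversal_opp (C : fieldType) (tau : set C) :
  is_transversal_mod_int tau -> is_transversal_mod_int [set c | tau (- c)]%classic.
Proof.
move=> tauZ c; have [t [[tt [m tm]] tU]] := tauZ (- c); exists (- t); split.
  split; first by rewrite /= opprK.
  by exists (- m); rewrite mulrNz -tm opprD !opprK.
move=> s [ts [l sl]]; rewrite -[s]opprK; congr (- _); apply: tU; split=> //.
by exists (- l); rewrite mulrNz -sl opprB opprK addrC.
Qed.

(** * The theorem *)

Theorem theorem8p16 (C : closedFieldType) (R : comUnitAlgType C)
    (r : set R) (tau : set C) :
  [pchar C] =i pred0 ->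
  is_local r -> is_noetherian R -> is_adic_complete r -> has_residue_field r ->
  is_transversal_mod_int tau ->
  (forall M : MC_log R, is_free M ->
     exists (W : lmodType R) (Wfg : fin_gen W) (B : {linear W -> W}),
       [/\ is_free_finite_rank W,
           conn_iso (gamma M) (gamma (eul B Wfg)) &
           forall lambda : C, reduction_eigenvalue r B lambda -> tau lambda])
  /\
  (forall (n : nat) (A : 'M[fps R]_n),
     exists (P : 'M[laurent R]_n) (B : 'M[R]_n),
       [/\ P \in unitmx,
           gauge_transform P (map_mx (@lau_of_fps R) A) = map_mx (@lau_const R) B &
           forall lambda : C,
             eigenvalue (map_mx (residue r) B) lambda -> tau lambda]).
Proof.
move=> charC [[idr _ _] _] _ cr resr tauZ.
have [rho [rhoE rhoC rker]] := residue_rmorphism idr resr.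
rewrite -rker in cr; split=> [M Mfree|n A].
  have [n [e [x ex]]] := free_fg_dual_basis (carrier_fg M) Mfree.
  have [H xH] := connection_matrix_exists ex.
  have [P [B [uP PE Btau]]] := tau_normal_form rhoC cr charC tauZ H.
  exists 'cV[R]_n, (cV_fin_gen R n), (mul_cV B); split.
  - exact: cV_free_finite_rank.
  - pose E := eul (mul_cV B) (cV_fin_gen R n).
    have xE := loc_connection_matrix (M := E) (tens_dual_basis R n)
      (@euler_connection_matrix R n B).
    have := @gauge_conn_iso _ _ _ _ (gamma M) (gamma E) n _ _ _ _ _ _ P
      (@lau_thetaD R) (@lau_thetaM R) (loc_dual_basis ex)
      (loc_dual_basis (M := E) (tens_dual_basis R n))
      (loc_connection_matrix ex xH) xE.
    apply; exists (invmx P); first exact: mulVmx.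
    by rewrite PE -map_mx_comp.
  - by move=> z; rewrite -rker => /(reduction_eigenvalue_mx rhoC)/Btau.
have [P [B [uP PE Btau]]] := tau_normal_form rhoC cr charC (transversal_opp tauZ) (- A).
exists P, (- B); split=> // [|z].
  rewrite /gauge_transform.
  have -> : map_mx (@lau_of_fps R) A *m P - map_mx (@lau_theta R) P =
      P *m map_mx (@lau_const R) (- B).
    by rewrite map_mxN mulmxN -PE map_mxN mulNmx opprD opprK.
  by rewrite mulKmx.
have -> : map_mx (residue r) (- B) = - map_mx rho B.
  by rewrite -map_mxN; apply/matrixP=> i j; rewrite [in LHS]mxE -rhoE [in RHS]mxE.
move=> /eigenvalueP[v vB v0]; rewrite -[z]opprK; apply: Btau.
by apply/eigenvalueP; exists v; rewrite // scaleNr -vB mulmxN opprK.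
Qed.
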